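(* Let $\Omega=(a,b)\subset\mathbb{R}$ be a finite open interval, $\alpha>0$ and $1\le p<\infty$. Then ${}^{\pm}\overline{W}^{\alpha,p}(\Omega)={}^{\pm}W^{\alpha,p}(\Omega)$ (the identity holds for the sign $-$ and for the sign $+$).
   Context: For $\alpha>0$ let $[\alpha]$ be its integer part and $n=[\alpha]+1$. For $\varphi\in C_0^\infty(\mathbb{R})$ the left and right classical (Riemann-Liouville) derivatives are ${}^{-}D^{\alpha}\varphi(x)=\frac{1}{\Gamma(n-\alpha)}\frac{d^n}{dx^n}\int_{-\infty}^x\frac{\varphi(y)}{(x-y)^{\alpha-n+1}}dy$ and ${}^{+}D^{\alpha}\varphi(x)=\frac{(-1)^n}{\Gamma(n-\alpha)}\frac{d^n}{dx^n}\int_x^{\infty}\frac{\varphi(y)}{(y-x)^{\alpha-n+1}}dy$. For $\varphi\in C_0^\infty(\Omega)$, $\tilde\varphi$ is its extension by zero to $\mathbb{R}$. Weak derivatives: for $u\in L^1(\Omega)$, $v\in L^1_{loc}(\Omega)$ is the left (resp. right) weak fractional derivative of $u$, written $v={}^{-}\mathcal{D}^{\alpha}u$ (resp. $v={}^{+}\mathcal{D}^{\alpha}u$), if $\int_\Omega v\varphi\,dx=(-1)^{[\alpha]}\int_\Omega u\,{}^{+}D^{\alpha}\tilde\varphi\,dx$ (resp. with ${}^{-}D^{\alpha}\tilde\varphi$) for all $\varphi\in C_0^\infty(\Omega)$. With $m=[\alpha]$, ${}^{\pm}W^{\alpha,p}(\Omega)=\{u\in W^{m,p}(\Omega): {}^{\pm}\mathcal{D}^{\alpha}u\in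 L^p(\Omega)\}$ (with $W^{0,p}=L^p$), with norm $\|u\|_{{}^{\pm}W^{\alpha,p}(\Omega)}=(\|u\|_{W^{m,p}(\Omega)}^p+\|{}^{\pm}\mathcal{D}^{\alpha}u\|_{L^p(\Omega)}^p)^{1/p}$ for $1\le p<\infty$. ${}^{\pm}\overline{W}^{\alpha,p}(\Omega)$ denotes the completion of $C^\infty(\Omega)$ (meaning those functions of $C^\infty(\Omega)$ for which the norm is defined and finite) in the norm $\|\cdot\|_{{}^{\pm}W^{\alpha,p}(\Omega)}$, i.e. its closure in ${}^{\pm}W^{\alpha,p}(\Omega)$. *)

(* Defs.v *)
From HB Require Import structures.
From mathcomp Require Import all_boot all_order all_algebra.
From mathcomp Require Import all_classical all_reals all_analysis.

Set Implicit Arguments.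
Unset Strict Implicit.
Unset Printing Implicit Defensive.
Import Order.TTheory GRing.Theory Num.Theory.
Import numFieldNormedType.Exports.

Local Open Scope classical_set_scope.
Local Open Scope ring_scope.

(* A function on an open set O of the line is represented by a total function
   R -> R whose values outside O are never used; [u \_ O] is its extension by
   zero.  Elements of the function spaces below are representatives: two
   functions equal almost everywhere on O stand for the same element. *)

Variant side := left_side | right_side.

Definition opposite (s : side) : side :=
  match s with left_side => right_side | right_side => left_side end.

Section fractional_sobolev.
Context {R : realType}.
Local Notation mu := (@lebesgue_measure R).
Implicit Types (O : set R) (f u v w phi : R -> R) (s : side) (alpha p : R).

Definition smooth_on O f : Prop :=
  forall (k : nat) (x : R), O x -> derivable (derive1n k f) x 1.

(* C_0^oo(O) *)
Definition test_function O phi : Prop :=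
  smooth_on O phi /\
  exists K : set R,
    [/\ compact K, K `<=` O & forall x, O x -> ~ K x -> phi x = 0].

Definition Lp O p : set (R -> R) :=
  [set u | u \_ O \in Lfun mu p%:E].

Definition Lp_norm O p u : \bar R := Lnorm mu p%:E (EFin \o (u \_ O)).

(* The Euler integral, used at arguments s > 0 only. *)
Definition Gamma (s : R) : R :=
  \int[mu]_(t in `]0, +oo[) (t `^ (s - 1) * expR (- t)).

(* Riemann-Liouville derivatives on the whole line, with n = [alpha] + 1. *)
Definition RL_deriv s alpha phi : R -> R :=
  let n := (Num.truncn alpha).+1 in
  match s with
  | left_side => fun x => (Gamma (n%:R - alpha))^-1 *
      derive1n n (fun z => \int[mu]_(y in `]-oo, z[)
                  (phi y / (z - y) `^ (alpha - n%:R + 1))) x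
  | right_side => fun x => (-1) ^+ n / Gamma (n%:R - alpha) *
      derive1n n (fun z => \int[mu]_(y in `]z, +oo[)
                  (phi y / (y - z) `^ (alpha - n%:R + 1))) x
  end.

Definition is_weak_deriv O (k : nat) u v : Prop :=
  [/\ locally_integrable O u, locally_integrable O v &
      forall phi, test_function O phi ->
        \int[mu]_(x in O) (v x * phi x) =
        (-1) ^+ k * \int[mu]_(x in O) (u x * derive1n k phi x)].

Definition is_weak_frac_deriv s O alpha u v : Prop :=
  [/\ Lp O 1 u, locally_integrable O v &
      forall phi, test_function O phi ->
        \int[mu]_(x in O) (v x * phi x) =
        (-1) ^+ (Num.truncn alpha) *
        \int[mu]_(x in O) (u x * RL_deriv (opposite s) alpha (phi \_ O) x)].

(* Weak derivatives are unique up to a null set of O when they exist; the two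
   operators below select a representative (and are zero otherwise). *)
Definition weak_deriv O (k : nat) u : R -> R :=
  xget (fun=> 0) [set v | is_weak_deriv O k u v].

Definition weak_frac_deriv s O alpha u : R -> R :=
  xget (fun=> 0) [set v | is_weak_frac_deriv s O alpha u v].

Definition sobolev O (m : nat) p : set (R -> R) :=
  [set u | Lp O p u /\
     forall k : nat, (0 < k <= m)%N ->
       exists2 v, is_weak_deriv O k u v & Lp O p v].

Definition sobolev_norm O (m : nat) p u : \bar R :=
  ((Lp_norm O p u `^ p +
    \sum_(1 <= k < m.+1) Lp_norm O p (weak_deriv O k u) `^ p) `^ p^-1)%E.

Definition frac_sobolev s O alpha p : set (R -> R) :=
  [set u | sobolev O (Num.truncn alpha) p u /\
     exists2 v, is_weak_frac_deriv s O alpha u v & Lp O p v].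

Definition frac_sobolev_norm s O alpha p u : \bar R :=
  ((sobolev_norm O (Num.truncn alpha) p u `^ p +
    Lp_norm O p (weak_frac_deriv s O alpha u) `^ p) `^ p^-1)%E.

(* The completion of C^oo(O), i.e. the closure in the fractional Sobolev space
   of its smooth elements: a smooth function has a defined and finite norm
   exactly when it belongs to that space. *)
Definition frac_sobolev_bar s O alpha p : set (R -> R) :=
  [set u | frac_sobolev s O alpha p u /\
     forall eps : R, 0 < eps ->
       exists g, [/\ smooth_on O g, frac_sobolev s O alpha p g &
         (frac_sobolev_norm s O alpha p (u \- g)%R < eps%:E)%E]].

End fractional_sobolev.

(* Main.v *)
(* Let c be the endpoint of (a, b) from which the fractional integral starts
   (c = a for the left derivative, c = b for the right one) and, for 0 < l < 1,
   let tau_l x = c + l (x - c), a contraction of (a, b) into itself.  A test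
   function transported by tau_l vanishes beyond tau_l (a, b), and so does its
   opposite-sided Riemann-Liouville derivative, which moreover scales by
   l ^ (- alpha); hence the weak fractional derivative of u o tau_l is
   l ^ alpha (v o tau_l) when v is that of u, and likewise for the integer
   derivatives.  Averaging u o tau_l against a smooth probability density k(l)
   supported in (eta, 1) gives a function that is smooth on (a, b), since after
   the substitution z = tau_l x the variable x only occurs in the kernel, and
   whose weak derivatives are the averages of l ^ gamma (w o tau_l).  These tend
   to w in L^p as eta -> 1, by Jensen's inequality and the continuity of
   dilations in L^p. *)
Require Import Defs.
From mathcomp Require Import all_boot all_order all_algebra.
From mathcomp Require Import all_classical all_reals all_analysis.
From mathcomp Require Import measurable_realfun ring lra.
Import Order.TTheory GRing.Theory Num.Theory.
Import numFieldNormedType.Exports.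
Set Implicit Arguments.
Unset Strict Implicit.
Unset Printing Implicit Defensive.
Local Open Scope classical_set_scope.
Local Open Scope ring_scope.

(** * Smooth functions *)

(** The usual density proof, by cutoffs and mollification with translates, fails here: a fractional
    derivative is nonlocal, so it obeys no Leibniz rule with local terms for a cutoff factor, and a
    translate of u is undefined near one endpoint. Contractions towards an endpoint need neither a
    cutoff nor an extension of u, and they only multiply a homogeneous operator by a power of l.
    Averaging over l is then mollification in the multiplicative group: each pointwise derivative of
    the average costs a factor 1 / (x - c), which blows up at c but is smooth on the open interval,
    and smoothness there is all that is asked. The weight l^gam depends on the order gam. The
    function u itself has order 0, so its approximant is the plain average, while each derivative is
    averaged with its own weighted kernel. That these averages are the derivatives of the
    approximant is seen only in weak form, by Fubini against test functions. One abstract operator T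
    can therefore stand for integer and fractional orders alike. The weights do no harm in the
    limit, because l^gam tends to 1 as l tends to 1. *)

Section smooth_functions.
Context {R : realType}.
Implicit Types (O : set R) (f g : R -> R).

Lemma is_derive_comp_eq f g (x a b d : R) : is_derive (g x) 1 f a ->
  is_derive x 1 g b -> a * b = d -> is_derive x 1 (fun y => f (g y)) d.
Proof. by move=> df dg <-; exact: (@is_derive1_comp _ f g). Qed.

Lemma is_deriveM_eq f g (x a b d : R) : is_derive x 1 f a ->
    is_derive x 1 g b ->
  f x * b + g x * a = d -> is_derive x 1 (fun y => f y * g y) d.
Proof. by move=> df dg <-; exact: (@is_deriveM _ _ f g). Qed.

Lemma is_deriveZ_eq f (k x a d : R) : is_derive x 1 f a -> k * a = d ->
  is_derive x 1 (fun y => k * f y) d.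
Proof. by move=> df <-; exact: (@is_deriveZ _ _ _ f). Qed.

Lemma is_deriveX_eq f n (x a d : R) : is_derive x 1 f a ->
  n%:R * f x ^+ n.-1 * a = d -> is_derive x 1 (fun y => f y ^+ n) d.
Proof.
move=> df <-; have -> : (fun y => f y ^+ n) = f ^+ n.
  by apply/funext => y; rewrite exprfctE.
exact: is_deriveX.
Qed.

(* Unlike [derive1n], this leaves the choice of the derivative off O free, which
   makes the stability under algebraic operations a plain induction. *)
Fixpoint diff_order O (k : nat) f : Prop :=
  if k is k'.+1 then
    exists2 f', (forall x, O x -> is_derive x 1 f (f' x)) & diff_order O k' f'
  else True.

Lemma eq_on_nbhs O f g (x : R) : open O -> O x -> (forall y, O y ->
    f y = g y) ->
  \near x, f x = g x.
Proof. by move=> oO Ox fg; near=> y; apply: fg; near: y; exact: open_nbhs_nbhs.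
Unshelve. all: by end_near. Qed.

Lemma eq_on_is_derive O f g (x d : R) : open O -> O x ->
  (forall y, O y -> f y = g y) -> is_derive x 1 f d -> is_derive x 1 g d.
Proof.
move=> oO Ox fg; apply: near_eq_is_derive.
by apply: (eq_on_nbhs oO Ox) => y /fg.
Qed.

Lemma diff_order_eq O k f g : open O -> (forall y, O y -> f y = g y) ->
  diff_order O k f -> diff_order O k g.
Proof.
move=> oO fg; case: k => // k [f' df f'k]; exists f' => // x Ox.
by apply: (eq_on_is_derive oO Ox fg); exact: df.
Qed.

Lemma diff_orderS O k f : diff_order O k.+1 f -> diff_order O k f.
Proof.
elim: k f => // k IH f [f' df f'k]; exists f' => //; exact: IH.
Qed.

Lemma diff_orderD O k f g : diff_order O k f -> diff_order O k g ->
  diff_order O k (fun x => f x + g x).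
Proof.
elim: k f g => // k IH f g [f' df f'k] [g' dg g'k].
exists (fun x => f' x + g' x); last exact: IH.
by move=> x Ox; have := df x Ox; have := dg x Ox => ? ?; exact: is_deriveD.
Qed.

Lemma diff_orderM O k f g : diff_order O k f -> diff_order O k g ->
  diff_order O k (fun x => f x * g x).
Proof.
elim: k f g => // k IH f g /[dup] fk [f' df f'k] /[dup] gk [g' dg g'k].
exists (fun x => f x * g' x + g x * f' x).
  by move=> x Ox; have := df x Ox; have := dg x Ox => ? ?; exact: is_deriveM.
by apply: diff_orderD; apply: IH => //; exact: diff_orderS.
Qed.

Lemma diff_order_cst O k (c : R) : diff_order O k (fun=> c).
Proof.
elim: k c => // k IH c; exists (fun=> 0) => // x Ox; exact: is_derive_cst.
Qed.

Lemma diff_order_id O k : diff_order O k id.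
Proof.
case: k => // k; exists (fun=> 1); last exact: diff_order_cst.
by move=> x Ox; exact: is_derive_id.
Qed.

Lemma diff_order_comp O k f g : diff_order setT k f -> diff_order O k g ->
  diff_order O k (fun x => f (g x)).
Proof.
elim: k f g => // k IH f g [f' df f'k] /[dup] gk [g' dg g'k].
exists (fun x => f' (g x) * g' x).
  by move=> x Ox; exact: (is_derive_comp_eq (df _ Logic.I) (dg _ Ox)).
by apply: diff_orderM => //; apply: IH => //; exact: diff_orderS.
Qed.

(** Derivatives are unique, so any admissible f' equals [derive1 f] on O. As O is open, the two then
    agree near each point and have the same further derivatives. *)
Lemma smooth_onP O f : open O -> smooth_on O f <-> forall k, diff_order O k f.
Proof.
move=> oO; split=> [sf k|df k].
  suff : forall j, diff_order O k (derive1n j f) by move=> /(_ 0%N).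
  elim: k => // k IH j; exists (derive1n j.+1 f); last exact: IH.
  by move=> x Ox; apply: DeriveDef; [exact: sf | rewrite derive1nS derive1E].
elim: k f df => [|k IH] f df x Ox.
  by have [f' /(_ x Ox) []] := df 1%N.
rewrite derive1Sn; apply: IH => // j.
have [f' df' f'j] := df j.+1; apply: diff_order_eq f'j => // y Oy.
by rewrite derive1E; have [_ <-] := df' y Oy.
Qed.

Lemma smooth_on_is_derive O f x : smooth_on O f -> O x ->
  is_derive x 1 f (derive1 f x).
Proof. by move=> /(_ 0%N x)/= sf Ox; apply: DeriveDef;
    [exact: sf | rewrite derive1E]. Qed.

Lemma smooth_on_derive1n O f k : smooth_on O f -> smooth_on O (derive1n k f).
Proof. by move=> sf j x Ox; rewrite /derive1n -iterD; exact: sf. Qed.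

Lemma smooth_on_eq O f g : open O -> (forall x, O x -> f x = g x) ->
  smooth_on O f -> smooth_on O g.
Proof. by move=> oO fg /(smooth_onP f oO) sf; apply/smooth_onP => // k;
    exact: diff_order_eq (sf k). Qed.

Lemma smooth_onD O f g : open O -> smooth_on O f -> smooth_on O g ->
  smooth_on O (fun x => f x + g x).
Proof.
move=> oO /(smooth_onP f oO) sf /(smooth_onP g oO) sg.
by apply/smooth_onP => // k; exact: diff_orderD.
Qed.

Lemma smooth_onM O f g : open O -> smooth_on O f -> smooth_on O g ->
  smooth_on O (fun x => f x * g x).
Proof.
move=> oO /(smooth_onP f oO) sf /(smooth_onP g oO) sg.
by apply/smooth_onP => // k; exact: diff_orderM.
Qed.

Lemma smooth_on_cst O (c : R) : open O -> smooth_on O (fun=> c).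
Proof. by move=> oO; apply/smooth_onP => // k; exact: diff_order_cst. Qed.

Lemma smooth_on_id O : open O -> smooth_on O id.
Proof. by move=> oO; apply/smooth_onP => // k; exact: diff_order_id. Qed.

Lemma smooth_on_comp O f g : open O -> smooth_on setT f -> smooth_on O g ->
  smooth_on O (fun x => f (g x)).
Proof.
move=> oO /(smooth_onP f openT) sf /(smooth_onP g oO) sg.
by apply/smooth_onP => // k; exact: diff_order_comp.
Qed.

Lemma smooth_on_continuous O f x : smooth_on O f -> O x -> {for x,
    continuous f}.
Proof.
move=> /(_ 0%N x)/= sf /sf /derivable1_diffP; exact: differentiable_continuous.
Qed.

(** The powers t^(-k) are included because the derivatives of exp(-1/t) are combinations of such
    terms. The family is closed under differentiation up to linear combinations. *)
Definition ebump_aux k (t : R) : R := if 0 < t then t^-1 ^+ k * expR (- t^-1)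
    else 0.

Definition ebump (t : R) : R := ebump_aux 0 t.

(** With y = 1/t this is exp(y) >= y^(k+1) / (k+1)!, one term of the exponential series. It gives
    the flatness at 0. *)
Lemma ebump_aux_le k (t : R) : 0 < t ->
  ebump_aux k t <= (k.+1)`!%:R * t.
Proof.
move=> t0; rewrite /ebump_aux t0.
have := @expR_ge1Dxn R (t^-1) k; rewrite invr_ge0 (ltW t0) => /(_ isT) h.
have h2 : t^-1 ^+ k.+1 / (k.+1)`!%:R <= expR t^-1.
  by apply: le_trans h; rewrite lerDr.
rewrite expRN ler_pdivrMr ?expR_gt0//.
have f0 : 0 < (k.+1)`!%:R :> R by rewrite ltr0n fact_gt0.
move: h2; rewrite ler_pdivrMr// exprS => h2.
rewrite -(ler_pM2l (_ : 0 < t^-1)) ?invr_gt0//.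
apply: (le_trans h2); rewrite mulrAC [_ * t]mulrC !mulrA mulVf ?gt_eqF// mul1r.
by rewrite mulrC.
Qed.

Lemma ebump_aux_ge0 k t : 0 <= ebump_aux k t.
Proof.
rewrite /ebump_aux; case: ifPn => // t0.
by rewrite mulr_ge0 ?expR_ge0// exprn_ge0// invr_ge0 ltW.
Qed.

Lemma is_derive_ebump_aux k (t : R) :
  is_derive t 1 (ebump_aux k) (- k%:R * ebump_aux k.+1 t + ebump_aux k.+2 t).
Proof.
have [t0|t0|->] := ltgtP t 0.
- have -> : - k%:R * ebump_aux k.+1 t + ebump_aux k.+2 t = 0.
    by rewrite /ebump_aux ltNge (ltW t0)/= mulr0 addr0.
  apply: (@near_eq_is_derive _ _ _ (cst 0)).
    near=> y; rewrite /ebump_aux ltNge ltW//=.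
    by near: y; exact: lt_nbhsl.
- have oO : open [set y : R | 0 < y] by exact: open_gt.
  rewrite /ebump_aux t0.
  apply: (@eq_on_is_derive _ (fun t => t^-1 ^+ k * expR (- t^-1)) _ _ _ oO t0).
  + by move=> y /= ->.
  + have tn0 : t != 0 by rewrite gt_eqF.
    have dV : is_derive t 1 (fun t : R => t^-1) (- t^-1 ^+ 2).
      by apply: is_derive_eq; [exact: (@is_deriveV _ id)|rewrite /= scaler1
          exprVn].
    have dE : is_derive t 1 (fun t : R => expR (- t^-1)) (expR (- t^-1) * t^-1
        ^+ 2).
      apply: (@is_derive_comp_eq expR (fun t : R => - t^-1)).
      by rewrite opprK.
    have dX : is_derive t 1 (fun t : R => t^-1 ^+ k) (- k%:R * t^-1 ^+ k.+1).
      apply: (is_deriveX_eq (f := fun t : R => t^-1)).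
      by case: k => [|k]; rewrite ?mulr0n ?oppr0 ?mul0r//= !exprS; ring.
    by apply: (is_deriveM_eq dX dE); rewrite !exprS; ring.
- have -> : - k%:R * ebump_aux k.+1 0 + ebump_aux k.+2 0 = 0 :> R.
    by rewrite /ebump_aux ltxx mulr0 addr0.
  suff : (h^-1 *: (ebump_aux k (h + 0) - ebump_aux k 0)) @[h --> (0:R)^'] -->
      (0 : R).
    move=> H; apply: DeriveDef.
      by apply/cvg_ex; exists 0; under eq_fun do rewrite [_%:A]scaler1.
    rewrite /derive; apply/cvg_lim => //.
    by under eq_fun do rewrite [_%:A]scaler1.
  (* For h > 0 the difference quotient at 0 is the member of index k+1 at h, to which [ebump_aux_le]
     applies. For h < 0 it is zero. *)
  apply: (@squeeze_cvgr _ _ _ _ (cst 0) (fun h => (k.+2)`!%:R * `|h|)).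
  + have b0 : ebump_aux k 0 = 0 by rewrite /ebump_aux ltxx.
    near=> h; rewrite addr0 b0 subr0 -[_ *: _]/(_ * _) /cst.
    have [h0|h0] := ltP 0 h; last first.
      by rewrite /ebump_aux ltNge h0/= mulr0 lexx/= mulr_ge0.
    have -> : h^-1 * ebump_aux k h = ebump_aux k.+1 h.
      by rewrite /ebump_aux h0 mulrA exprS.
    by rewrite ebump_aux_ge0 (gtr0_norm h0)/= ebump_aux_le.
  + exact: cvg_cst.
  + have : (k.+2)`!%:R * `|h| @[h --> (0:R)^'] --> (k.+2)`!%:R * `|0 : R|.
      by apply: cvgM; [exact: cvg_cst | apply: cvg_norm; exact: cvg_within].
    by rewrite normr0 mulr0.
Unshelve. all: by end_near. Qed.

Lemma smooth_ebump : smooth_on setT ebump.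
Proof.
apply/smooth_onP => [|k]; first exact: openT.
(* Differentiation raises the index of [ebump_aux], so the induction on the order must cover all
   indices at once. *)
rewrite /ebump; move: 0%N; elim: k => // k IH j.
exists (fun t => - j%:R * ebump_aux j.+1 t + ebump_aux j.+2 t).
  by move=> x _; exact: is_derive_ebump_aux.
apply: diff_orderD => //; apply: diff_orderM => //; exact: diff_order_cst.
Qed.

Lemma ebump_ge0 t : 0 <= ebump t. Proof. exact: ebump_aux_ge0. Qed.

Lemma ebump_le1 t : ebump t <= 1.
Proof.
rewrite /ebump /ebump_aux; case: ifPn => // t0; rewrite expr0 mul1r expR_le1.
by rewrite oppr_le0 invr_ge0 ltW.
Qed.

Lemma ebump_gt0 t : 0 < t -> 0 < ebump t.
Proof. by move=> t0; rewrite /ebump /ebump_aux t0 expr0 mul1r expR_gt0. Qed.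

Lemma ebump_eq0 t : t <= 0 -> ebump t = 0.
Proof. by move=> t0; rewrite /ebump /ebump_aux ltNge t0. Qed.

End smooth_functions.

(** * Affine substitutions *)

Section affine_substitution.
Context {R : realType}.
Local Notation mu := (@lebesgue_measure R).
Variables (c d : R).
Hypothesis c0 : c != 0.
Let aff : measurableTypeR R -> measurableTypeR R := fun x => c * x + d.

Lemma measurable_affine : measurable_fun setT aff.
Proof. by apply: measurable_funD => //; exact: measurable_funM. Qed.

Let image_measure : {measure set (measurableTypeR R) -> \bar R} :=
  measure_function_pushforward__canonical__measure_function_Measure mu
    measurable_affine.

(** By uniqueness of Lebesgue measure, half-open intervals suffice. For c < 0 the preimage is
    half-open at the other end, which leaves its length unchanged. *)
Lemma lebesgue_measure_affine (A : set (measurableTypeR R)) : measurable A ->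
  (`|c|%:E * mu (aff @^-1` A) = mu A)%E.
Proof.
move=> mA; pose k : {nonneg R} := NngNum (normr_ge0 c).
apply/esym.
apply: (@lebesgue_measure_unique R (mscale k image_measure)) => //.
move=> _ [[p q]] _ <-; rewrite -[RHS]/((`|c|%:E * mu (aff @^-1` `]p, q]))%E).
have := c0; rewrite neq_lt => /orP[cn|cp].
- have -> : aff @^-1` `]p, q] = `[(q - d) / c, (p - d) / c[%classic.
    apply/seteqP; split=> x /=; rewrite !in_itv/= ler_ndivrMr// ltr_ndivlMr//;
      rewrite /aff; lra.
  rewrite !lebesgue_measure_itv/= !lte_fin ltr_nM2r ?invr_lt0// ltrD2r.
  case: ifPn => pq; last by rewrite mule0.
  rewrite -!EFinD -EFinM ltr0_norm//; congr EFin; field; exact: c0.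
- have -> : aff @^-1` `]p, q] = `](p - d) / c, (q - d) / c]%classic.
    apply/seteqP; split=> x /=; rewrite !in_itv/= ler_pdivlMr// ltr_pdivrMr//;
      rewrite /aff; lra.
  rewrite !lebesgue_measure_itv/= !lte_fin ltr_pM2r ?invr_gt0// ltrD2r.
  case: ifPn => pq; last by rewrite mule0.
  rewrite -!EFinD -EFinM gtr0_norm//; congr EFin; field; exact: c0.
Qed.

Lemma ge0_integral_affine (D : set R) (f : R -> \bar R) : measurable D ->
  measurable_fun D f -> (forall x, D x -> 0 <= f x)%E ->
  (\int[mu]_(y in D) f y =
   `|c|%:E * \int[mu]_(x in [set x | D (c * x + d)%R]) f (c * x + d)%R)%E.
Proof.
move=> mD mf f0; pose k : {nonneg R} := NngNum (normr_ge0 c).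
rewrite -[X in _ = (_ * X)%E](@ge0_integral_pushforward _ _ _ _ _ _
    measurable_affine)//; last first.
  by move=> y /set_mem; exact: f0.
transitivity (\int[mscale k image_measure]_(y in D) f y)%E.
  apply: eq_measure_integral => A mA _.
  exact/esym/lebesgue_measure_affine.
rewrite ge0_integral_mscale//.
Qed.

(** No integrability is assumed, so the factor is distributed over the difference of positive and
    negative parts case by case, infinite values included. *)
Lemma integral_affine (D : set R) (f : R -> \bar R) : measurable D ->
  measurable_fun D f ->
  (\int[mu]_(y in D) f y =
   `|c|%:E * \int[mu]_(x in [set x | D (c * x + d)%R]) f (c * x + d)%R)%E.
Proof.
move=> mD mf; rewrite [LHS]integralE [in RHS]integralE.
rewrite (ge0_integral_affine mD (measurable_funepos mf)) => [|x _];
    last exact: funepos_ge0.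
rewrite (ge0_integral_affine mD (measurable_funeneg mf)) => [|x _];
    last exact: funeneg_ge0.
have k0 : 0 < `|c| by rewrite normr_gt0.
set A := (X in (_ * X - _)%E); set B := (X in (_ - _ * X)%E).
have A0 : (0 <= A)%E by apply: integral_ge0 => x _; exact: funepos_ge0.
have B0 : (0 <= B)%E by apply: integral_ge0 => x _; exact: funeneg_ge0.
transitivity (`|c|%:E * (A - B))%E; last first.
  have H1 : ((fun x => f (c * x + d)%R)^\+ = (fun x =>
      f^\+ (c * x + d)%R))%E by apply/funext => x; rewrite !funeposE.
  have H2 : ((fun x => f (c * x + d)%R)^\- = (fun x =>
      f^\- (c * x + d)%R))%E by apply/funext => x; rewrite !funenegE.
  by rewrite H1 H2.
case: A A0 B B0 => [x| |]// x0 [y| |]// y0.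
- by rewrite muleBr.
- by rewrite /= gt0_muley// gt0_muleNy.
- by rewrite /= gt0_muley.
- by rewrite /= gt0_muley// gt0_muleNy.
Qed.

Lemma Rintegral_affine (D : set R) (f : R -> R) : measurable D ->
  measurable_fun D f ->
  \int[mu]_(y in D) f y =
   `|c| * \int[mu]_(x in [set x | D (c * x + d)]) f (c * x + d).
Proof.
move=> mD mf; rewrite /Rintegral (integral_affine mD);
    last exact/measurable_EFinP.
set A := (X in fine (_ * X)%E); rewrite -/A.
have k0 : 0 < `|c| by rewrite normr_gt0.
by case: A => [x| |]//=; rewrite ?gt0_muley ?gt0_muleNy//= mulr0.
Qed.

Lemma measurable_preimage_affine (D : set R) : measurable D ->
  measurable [set x | D (c * x + d)].
Proof. by move=> mD; have := measurable_affine measurableT mD;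
    rewrite setTI. Qed.

Lemma integrable_affine (D : set R) (f : R -> R) : measurable D ->
  mu.-integrable D (EFin \o f) ->
  mu.-integrable [set x | D (c * x + d)] (EFin \o (fun x => f (c * x + d))).
Proof.
move=> mD /integrableP[/measurable_EFinP mf foo].
have mD' := measurable_preimage_affine mD.
apply/integrableP; split.
  apply/measurable_EFinP; apply: (@measurable_comp _ _ _ _ _ _ D f _ aff) => //.
  - by move=> _ /= [x Dx <-].
  - exact: measurable_funS measurable_affine.
move: foo; rewrite ge0_integral_affine//; last first.
  by apply: measurableT_comp => //; exact/measurable_EFinP.
have k0 : 0 < `|c| by rewrite normr_gt0.
move=> H; rewrite ltey; apply/eqP => E; move: H; rewrite E gt0_muley// ?ltxx//.
Qed.

End affine_substitution.

(** * Test functions and the fundamental lemma *)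

Section bounded_multiples.
Context d (T : measurableType d) {R : realType} (mu : {measure set T ->
    \bar R}).
Implicit Types (D : set T) (f g : T -> R).

Lemma integrableM_bounded D f g (M : R) : measurable D ->
  mu.-integrable D (EFin \o f) -> measurable_fun D g ->
  (forall x, D x -> `|g x| <= M) ->
  mu.-integrable D (EFin \o (fun x => f x * g x)).
Proof.
move=> mD intf mg gM; have /integrableP[/measurable_EFinP mf _] := intf.
apply: (@le_integrable _ _ _ _ _ mD _ (EFin \o (fun x => M * f x))).
- by apply/measurable_EFinP; exact: measurable_funM.
- move=> x Dx; rewrite /= lee_fin normrM [in leRHS]normrM mulrC ler_wpM2r//.
  by rewrite (le_trans (gM x Dx))// ler_norm.
- by have := integrableZl mD M intf; apply: eq_integrable => // x _;
    rewrite /= EFinM.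
Qed.

Lemma Rintegral_eq0P D f : measurable D -> mu.-integrable D (EFin \o f) ->
  \int[mu]_(x in D) f x = 0 -> (\int[mu]_(x in D) (f x)%:E = 0)%E.
Proof.
move=> mD intf; rewrite /Rintegral => h.
by rewrite -[LHS]fineK ?h//; exact: integrable_fin_num.
Qed.

End bounded_multiples.

Section compactly_supported.
Context {R : realType}.
Local Notation mu := (@lebesgue_measure R).
Implicit Types (O : set R) (f phi w : R -> R).

(** Test functions in extended form. Being smooth on the whole line, they can be shifted and dilated
    without regard to O. *)
Definition cc_smooth O f := smooth_on setT f /\
  exists K : set R, [/\ compact K, K `<=` O & forall x, ~ K x -> f x = 0].

Lemma derive1n_eq O f g k : open O -> (forall x, O x -> f x = g x) ->
  forall x, O x -> derive1n k f x = derive1n k g x.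
Proof.
move=> oO fg; elim: k => [//|k IH] x Ox; rewrite !derive1nS !derive1E.
by apply: near_eq_derive; exact: eq_on_nbhs oO Ox IH.
Qed.

Lemma cc_smooth_derive1n O f k : cc_smooth O f -> cc_smooth O (derive1n k f).
Proof.
move=> [sf [K [cK KO K0]]]; split; first exact: smooth_on_derive1n.
exists K; split=> // x Kx.
have oK : open (~` K) by apply: closed_openC; exact: compact_closed.
rewrite (@derive1n_eq (~` K) f (cst 0) k oK)//.
suff -> : derive1n k (cst 0 : R -> R) = cst 0 by [].
elim: k => // k IH; rewrite derive1nS IH; apply/funext => y; exact: derive1_cst.
Qed.

Lemma cc_smooth_bounded O f : cc_smooth O f -> exists M : R, forall x,
    `|f x| <= M.
Proof.
move=> [sf [K [cK _ K0]]].
have : bounded_set (f @` K).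
  apply/compact_bounded/continuous_compact => //.
  by apply: continuous_subspaceT => x; exact: (smooth_on_continuous sf).
move=> [N [_ /(_ (`|N| + 1))]].
have NN : N < `|N| + 1 by rewrite (le_lt_trans (ler_norm _))// ltrDl.
move=> /(_ NN) fN; exists (`|N| + 1) => x.
have [Kx|Kx] := pselect (K x); first by apply: fN; exists x.
by rewrite K0// normr0 addr_ge0.
Qed.

Lemma cc_smooth_measurable O f (D : set R) : cc_smooth O f ->
    measurable_fun D f.
Proof.
move=> [sf _]; apply: measurable_funTS; apply: continuous_measurable_fun => x.
exact: (smooth_on_continuous sf).
Qed.

Lemma cc_smooth_test O f : cc_smooth O f -> test_function O f.
Proof.
move=> [sf [K [cK KO K0]]]; split; first by move=> k x _; exact: sf.
by exists K; split=> // x _; exact: K0.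
Qed.

(** The open sets O and the complement of the support K cover the line. The extension is [phi] on
    the first and zero on the second. *)
Lemma test_cc_smooth O phi : open O -> test_function O phi ->
    cc_smooth O (phi \_ O).
Proof.
move=> oO [sphi [K [cK KO K0]]].
have K1 x : ~ K x -> (phi \_ O) x = 0.
  by move=> Kx; rewrite patchE; case: ifPn => // /set_mem Ox; exact: K0.
split; last by exists K.
have oK : open (~` K) by apply: closed_openC; exact: compact_closed.
move=> k x _; have [Kx|Kx] := pselect (K x).
  have : smooth_on O (phi \_ O).
    by apply: smooth_on_eq sphi => // y Oy; rewrite patchE mem_set.
  by apply; exact: KO.
have : smooth_on (~` K) (phi \_ O).
  by apply: (@smooth_on_eq _ _ (cst 0)) => [//|y /K1 ->//|];
      exact: smooth_on_cst.
exact.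
Qed.

Lemma cc_smooth_integrable O w f : cc_smooth O f -> locally_integrable O w ->
  mu.-integrable O (EFin \o (fun x => w x * f x)).
Proof.
move=> ccf [mw oO wloc]; have [M fM] := cc_smooth_bounded ccf.
have mf := @cc_smooth_measurable O f O ccf.
move: ccf => [_ [K [cK KO K0]]].
have mK := compact_measurable cK.
have mO := open_measurable oO.
have intK : mu.-integrable K (EFin \o w).
  apply/integrableP; split; last exact: wloc.
  by apply/measurable_EFinP; exact: measurable_funS mw.
have : mu.-integrable (O `&` K) (EFin \o (fun x => w x * f x)).
  rewrite (_ : O `&` K = K); last by apply/setIidPr.
  apply: (@integrableM_bounded _ _ _ _ _ _ _ M) => //.
  exact: measurable_funS mf.
move=> /((integrable_restrict mu mK mO _).1).
apply: eq_integrable => // x _; rewrite patchE; case: ifPn => //.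
by rewrite notin_setE => /K0 fx; rewrite /= fx mulr0.
Qed.

(** The quadratic is positive only between p and q. The factor n steepens the bump into an indicator
    function in the limit, and n = 1 later provides the averaging kernel. *)
Lemma ebump_itv_cc_smooth (a b p q : R) (n : nat) : a < p -> p <= q -> q < b ->
  cc_smooth `]a, b[ (fun x => ebump (n%:R * ((x - p) * (q - x)))).
Proof.
move=> ap pq qb; split.
  apply: smooth_on_comp; [exact: openT | exact: smooth_ebump |].
  have s1 : smooth_on setT (fun x : R => x - p).
    by apply: smooth_onD; [exact: openT | apply: smooth_on_id;
        exact: openT | apply: smooth_on_cst; exact: openT].
  have s2 : smooth_on setT (fun x : R => q - x).
    rewrite (_ : (fun x : R => q - x) = (fun x => q + (-1) * x)); last first.
      by apply/funext => x; rewrite mulN1r.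
    apply: smooth_onD; [exact: openT | apply: smooth_on_cst; exact: openT |].
    by apply: smooth_onM; [exact: openT | apply: smooth_on_cst;
        exact: openT| apply: smooth_on_id; exact: openT].
  apply: smooth_onM; [exact: openT | apply: smooth_on_cst; exact: openT |].
  by apply: smooth_onM => //; exact: openT.
exists `[p, q]%classic; split; first exact: segment_compact.
  by move=> x /=; rewrite !in_itv/= => /andP[? ?];
      rewrite (lt_le_trans ap)//= (le_lt_trans _ qb).
move=> x /= /negP; rewrite in_itv/= negb_and -!ltNge => h; apply: ebump_eq0.
apply: mulr_ge0_le0 => //; case/orP: h => h; nra.
Qed.

Lemma cvg_ebump_itv (p q x : R) : p <= q ->
  ebump (n.+1%:R * ((x - p) * (q - x))) @[n --> \oo] --> (\1_(`]p, q[%classic)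
      x : R).
Proof.
move=> pq; rewrite indicE; case: (boolP (x \in _)) => [/set_mem|/negP];
    rewrite ?inE /= in_itv/=.
  move=> /andP[px xq]; have c0 : 0 < (x - p) * (q - x) by rewrite mulr_gt0
      ?subr_gt0.
  set c := (x - p) * (q - x) in c0 *.
  have : expR (- (n.+1%:R * c)^-1) @[n --> \oo] --> (1 : R).
    have h0 : - (n.+1%:R * c)^-1 @[n --> \oo] --> - (0 * c^-1 : R).
      apply: cvgN; under eq_fun do rewrite invfM.
      by apply: cvgMl; exact: cvg_harmonic.
    rewrite mul0r oppr0 in h0.
    have := continuous_cvg _ (@continuous_expR R 0) h0;
        rewrite [X in _ --> X]expR0.
    by apply.
  apply: cvg_trans; apply: near_eq_cvg; apply: nearW => n.
  have n0 : 0 < n.+1%:R * c by rewrite mulr_gt0.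
  by rewrite /ebump /ebump_aux n0 expr0 mul1r.
move=> h; apply: cvg_near_cst; apply: nearW => n; apply: ebump_eq0.
apply: mulr_ge0_le0 => //; move/negP: h; rewrite negb_and -!leNgt =>
    /orP[h|h]; nra.
Qed.

(* The bumps of [cvg_ebump_itv] are test functions bounded by 1, so the integral
   of w over ]p, q[ is a dominated limit of zeros. *)
Lemma weak_zero_itv (a b : R) w : locally_integrable `]a, b[ w ->
  (forall phi, cc_smooth `]a, b[ phi -> \int[mu]_(x in `]a, b[) (w x * phi x) =
      0) ->
  forall p q, a < p -> q < b -> \int[mu]_(x in `[p, q]) w x = 0.
Proof.
move=> wloc w0 p q ap qb.
have [qp|pq] := ltP q p; first by rewrite set_itv_ge ?bnd_simp -?ltNge//
    Rintegral_set0.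
have KO : `[p, q] `<=` `]a, b[.
  by move=> x /=; rewrite !in_itv/= => /andP[? ?];
      rewrite (lt_le_trans ap)//= (le_lt_trans _ qb).
have [mw oO wK] := wloc.
have intw : mu.-integrable `[p, q] (EFin \o w).
  apply/integrableP; split; last by apply: wK => //; exact: segment_compact.
  by apply/measurable_EFinP; exact: measurable_funS mw.
pose phi n x := ebump (n.+1%:R * ((x - p) * (q - x))).
have mphi n (D : set R) : measurable_fun D (phi n).
  by apply: (@cc_smooth_measurable `]a, b[); exact: ebump_itv_cc_smooth.
have phi1 n x : `|phi n x| <= 1 by rewrite ger0_norm ?ebump_ge0// ebump_le1.
have z n : (\int[mu]_(x in `[p, q]) (w x * phi n x)%:E = 0)%E.
  apply: Rintegral_eq0P => //.
    exact: (integrableM_bounded _ intw (mphi n _) (fun x _ => phi1 n x)).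
  rewrite -[RHS](w0 (phi n)); last exact: ebump_itv_cc_smooth.
  rewrite Rintegral_mkcond [RHS]Rintegral_mkcond; apply: eq_Rintegral => x _.
  rewrite !patchE; case: ifPn => [/set_mem/KO Ox|xpq]; first by rewrite mem_set.
  case: ifPn => // _; rewrite (_ : phi n x = 0) ?mulr0//.
  apply: ebump_eq0; move: xpq; rewrite notin_setE /= in_itv/= => /negP.
  rewrite negb_and -!ltNge => h; apply: mulr_ge0_le0 => //; case/orP: h => h;
      nra.
have : (\int[mu]_(x in `[p, q]) (w x * phi n x)%:E @[n --> \oo] -->
    \int[mu]_(x in `[p, q]) (w x * \1_(`]p, q[%classic) x)%:E)%E.
  have := @dominated_cvg _ _ _ mu `[p, q] _ (fun n x => (w x * phi n x)%:E)
    (fun x => (w x * \1_(`]p, q[%classic) x)%:E) (fun x => `|w x|%:E).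
  apply => //.
  - move=> n; apply/measurable_EFinP/measurable_funM; last exact: mphi.
    by case/integrableP : intw => /measurable_EFinP.
  - move=> x _; apply: cvg_EFin; first exact: nearW.
    by apply: cvgMr; exact: cvg_ebump_itv.
  - by apply: (integrable_abse intw).
  - by move=> n x _; rewrite /= lee_fin normrM ler_piMr.
under eq_fun do rewrite z.
move=> /(cvg_unique (@ereal_hausdorff _) (cvg_cst _)) h.
rewrite -Rintegral_itv_bndo_bndc; last first.
  apply: integrableS intw => //; exact: subset_itv_co_cc.
rewrite -Rintegral_itv_obnd_cbnd; last first.
  by apply: integrableS intw => //; exact: subset_itv_oo_cc.
rewrite /Rintegral -[RHS]/(fine 0%E) h; congr fine.
rewrite integral_mkcond [RHS]integral_mkcond; apply: eq_integral => x _.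
rewrite !patchE indicE; case: ifPn => [/set_mem H|_];
    first by rewrite mem_set ?mulr1//; exact: subset_itv_oo_cc.
by case: ifPn => //; rewrite mulr0.
Qed.

(** The primitive of w restricted to [p, q] vanishes identically. By Lebesgue differentiation w is
    therefore zero almost everywhere on ]p, q[, and countably many such intervals exhaust ]a, b[. *)
Lemma weak_zero (a b : R) w : locally_integrable `]a, b[ w ->
  (forall phi, cc_smooth `]a, b[ phi -> \int[mu]_(x in `]a, b[) (w x * phi x) =
      0) ->
  {ae mu, forall x, `]a, b[%classic x -> w x = 0}.
Proof.
move=> wloc /(weak_zero_itv wloc) w0.
have [mw oO wK] := wloc.
have aeK p q : a < p -> q < b -> {ae mu, forall x, `]p, q[%classic x ->
    w x = 0}.
  move=> ap qb.
  have KO : `[p, q] `<=` `]a, b[.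
    by move=> x /=; rewrite !in_itv/= => /andP[? ?];
        rewrite (lt_le_trans ap)//= (le_lt_trans _ qb).
  have intw : mu.-integrable `[p, q] (EFin \o w).
    apply/integrableP; split; last by apply: wK => //; exact: segment_compact.
    by apply/measurable_EFinP; exact: measurable_funS mw.
  have F0 y : \int[mu]_(t in `]-oo, y]) (w \_ `[p, q]) t = 0.
    rewrite -Rintegral_mkcondr.
    rewrite (_ : `]-oo, y] `&` `[p, q] = `[p, Num.min y q]%classic).
      by apply: w0 => //; rewrite gt_min qb orbT.
    apply/seteqP; split => x /=; rewrite !in_itv/= le_min;
        first by move=> [-> /andP[-> ->]].
    by move=> /andP[-> /andP[-> ->]].
  have Hi y : mu.-integrable `]-oo, y] (EFin \o (w \_ `[p, q])).
    rewrite -restrict_EFin; apply/integrable_restrict => //.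
    by apply: integrableS intw => //; exact: measurableI.
  have Hl : locally_integrable setT (w \_ `[p, q]) by exact:
      integrable_locally_restrict.
  have := FTC1Ny Hi Hl; apply: filterS;
      first exact: (ae_filter_ringOfSetsType mu).
  move=> x [_]; rewrite (_ : (fun _ => _) = cst 0); last first.
      by apply/funext => y; exact: F0.
    move=> h /= xpq; move: h; rewrite derive1_cst patchE mem_set//.
    exact: subset_itv_oo_cc.
have : {ae mu, forall x, forall n : nat, `](a + n.+1%:R^-1),
    (b - n.+1%:R^-1)[%classic x -> w x = 0}.
  by apply: ae_foralln => n; apply: aeK; rewrite ?ltrDl ?gtrBl invr_gt0.
apply: filterS; first exact: (ae_filter_ringOfSetsType mu).
move=> x H /=; rewrite in_itv/= => /andP[ax xb].
have e1 : 0 < x - a by rewrite subr_gt0.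
have e2 : 0 < b - x by rewrite subr_gt0.
near \oo => n; apply: (H n); rewrite /= in_itv/=; apply/andP; split.
  by rewrite -ltrBrDl; near: n; exact: (near_infty_natSinv_lt (PosNum e1)).
by rewrite ltrBrDr -ltrBrDl; near: n;
    exact: (near_infty_natSinv_lt (PosNum e2)).
Unshelve. all: by end_near. Qed.

End compactly_supported.

(** * Dilations *)

Section powers.
Context {R : realType}.
Local Notation mu := (@lebesgue_measure R).

(** On [T / (n+2), T] the explicit primitive [F] bounds the integral by F(T), uniformly in n.
    Monotone convergence carries the bound down to 0. *)
Lemma integrable_powR0 (s T : R) : s < 1 -> 0 < T ->
  mu.-integrable `]0, T[ (EFin \o (fun t => t `^ (- s))).
Proof.
move=> s1 T0; have r0 : 0 < 1 - s by rewrite subr_gt0.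
pose F (t : R) := (1 - s)^-1 * t `^ (1 - s).
have dF (t : R) : 0 < t -> is_derive t 1 F (t `^ (- s)).
  move=> t0; apply: (is_deriveZ_eq (is_derive1_powR _ t0)).
  by rewrite mulrA mulVf ?gt_eqF// mul1r; congr powR; ring.
have cF (t : R) : 0 < t -> {for t, continuous F}.
  by move=> t0; have [/derivable1_diffP/differentiable_continuous] := dF t t0.
have cf (t : R) : 0 < t -> {for t, continuous (fun t : R => t `^ (- s))}.
  move=> t0; have [/derivable1_diffP/differentiable_continuous h _] :=
      is_derive1_powR (- s) t0.
  exact: h.
have mf (D : set R) : measurable_fun D (fun t : R => (t `^ (- s))%:E).
  by apply/measurable_EFinP/measurable_funTS; exact: measurable_powR.
apply/integrableP; split; first exact: mf.
rewrite (_ : (fun x => _) = (fun t => (t `^ (- s))%:E)); last first.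
  by apply/funext => t; rewrite /= ger0_norm ?powR_ge0.
(* The shift by 2 keeps the left endpoint strictly below T even for n = 0, as the fundamental
   theorem requires. *)
pose I (n : nat) : set R := `[T / n.+2%:R, T]%classic.
have I0 n : 0 < T / n.+2%:R by rewrite divr_gt0.
have hcvg : (\int[mu]_(x in I n) (x `^ (- s))%:E @[n --> \oo] -->
    \int[mu]_(x in \bigcup_n I n) (x `^ (- s))%:E)%E.
  apply: ge0_nondecreasing_set_cvg_integral.
  - move=> n m nm; apply/subsetPset; apply: subset_itvr; rewrite bnd_simp.
    by rewrite ler_pM2l// lef_pV2 ?posrE// ler_nat !ltnS.
  - by move=> n; exact: measurable_itv.
  - by move=> n; exact: mf.
  - by move=> n x _; rewrite lee_fin powR_ge0.
have hle : (\int[mu]_(x in \bigcup_n I n) (x `^ (- s))%:E <= (F T)%:E)%E.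
  rewrite -(cvg_lim _ hcvg)//; apply: lime_le; first by apply/cvg_ex; eexists;
      exact: hcvg.
  apply: nearW => n; rewrite (@continuous_FTC2 _ _ F).
  - by rewrite -EFinB lee_fin gerBl mulr_ge0 ?powR_ge0// invr_ge0 ltW.
  - by rewrite ltr_pdivrMr// ltr_pMr// ltr1n.
  - apply: continuous_in_subspaceT => x /set_mem /=; rewrite in_itv/= =>
      /andP[+ _].
    by move=> /(lt_le_trans (I0 n)); exact: cf.
  - split.
    + move=> x; rewrite in_itv/= => /andP[/(lt_trans (I0 n)) x0 _].
      by have [] := dF x x0.
    + by apply: cvg_at_right_filter; exact: cF.
    + by apply: cvg_at_left_filter; exact: cF.
  - move=> x; rewrite in_itv/= => /andP[/(lt_trans (I0 n)) x0 _].
    by rewrite derive1E; have [_ ->] := dF x x0.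
apply: le_lt_trans (le_lt_trans hle (ltry _)).
apply: ge0_subset_integral.
- exact: measurable_itv.
- by apply: bigcup_measurable => n _; exact: measurable_itv.
- exact: mf.
- by move=> x _; rewrite lee_fin powR_ge0.
- move=> x /=; rewrite in_itv/= => /andP[x0 xT].
  have e0 : 0 < x / T by rewrite divr_gt0.
  near \oo => n; exists n => //; rewrite /I /= in_itv/= (ltW xT) andbT.
  rewrite mulrC -ler_pdivlMr//; apply: ltW.
  apply: (@le_lt_trans _ _ (n.+1%:R^-1));
      first by rewrite lef_pV2 ?posrE// ler_nat.
  by near: n; exact: (near_infty_natSinv_lt (PosNum e0)).
Unshelve. all: by end_near. Qed.

End powers.

Section dilations.
Context {R : realType}.
Local Notation mu := (@lebesgue_measure R).
Implicit Types (f : R -> R) (c l x : R).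

Definition dil c l x : R := c + l * (x - c).

(** This is f composed with the inverse of [dil c l]: points move by [dil], and functions are
    carried along with their supports. *)
Definition dil_fun c l f x : R := f (c + l^-1 * (x - c)).

Lemma dilE c l x : dil c l x = l * x + (c - l * c).
Proof. by rewrite /dil; ring. Qed.

Lemma dilK c l x : l != 0 -> c + l^-1 * (dil c l x - c) = x.
Proof. by move=> l0; rewrite /dil; field. Qed.

Lemma dil_in (a b : R) c l x : a <= c <= b -> 0 < l -> l <= 1 ->
  x \in `]a, b[ -> dil c l x \in `]a, b[.
Proof.
move=> /andP[ac cb] l0 l1; rewrite /dil !in_itv/= => /andP[ax xb].
by apply/andP; split; nra.
Qed.

Lemma derive1n_dil_fun c l f k x : smooth_on setT f ->
  derive1n k (dil_fun c l f) x = l^-1 ^+ k * derive1n k f (c + l^-1 * (x - c)).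
Proof.
move=> sf; elim: k x => [|k IH] x; first by rewrite expr0 mul1r.
rewrite derive1nS; have -> : derive1n k (dil_fun c l f) = (fun x =>
    l^-1 ^+ k * derive1n k f (c + l^-1 * (x - c))).
  by apply/funext => y; exact: IH.
rewrite derive1E.
have dg : is_derive x 1 (fun x : R => c + l^-1 * (x - c)) (l^-1).
  have -> : (fun x : R => c + l^-1 * (x - c)) = (fun x =>
      l^-1 * x) \+ cst (c - l^-1 * c).
    by apply/funext => y /=; ring.
  have h : is_derive x 1 (fun x : R => l^-1 * x) l^-1.
    by apply: (is_deriveZ_eq (is_derive_id _ _)); rewrite mulr1.
  by have := is_deriveD h (is_derive_cst (c - l^-1 * c) x 1); rewrite addr0.
have df : is_derive (c + l^-1 * (x - c)) 1 (derive1n k f) (derive1n k.+1 f (c +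
    l^-1 * (x - c))).
  by have := smooth_on_is_derive (smooth_on_derive1n (k := k) sf) (Logic.I :
      setT (c + l^-1 * (x - c))).
have d2 := is_derive_comp_eq (g := fun x => c + l^-1 * (x - c)) df dg erefl.
have [_ ->] := is_deriveZ_eq (k := l^-1 ^+ k) d2 erefl.
by rewrite exprS; ring.
Qed.

Lemma dil_fun_cc_smooth (a b : R) c l f : a <= c <= b -> 0 < l -> l <= 1 ->
  cc_smooth `]a, b[ f -> cc_smooth `]a, b[ (dil_fun c l f).
Proof.
move=> acb l0 l1 [sf [K [cK KO K0]]]; split.
  apply: smooth_on_comp; [exact: openT|exact: sf|].
  rewrite (_ : (fun x : R => _) = (fun x => l^-1 * x + (c - l^-1 * c)));
      last first.
    by apply/funext => y /=; ring.
  apply: smooth_onD; [exact: openT | | apply: smooth_on_cst; exact: openT].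
  by apply: smooth_onM; [exact: openT | apply: smooth_on_cst;
      exact: openT| apply: smooth_on_id; exact: openT].
exists (dil c l @` K); split.
- apply: continuous_compact => //; apply: continuous_subspaceT => x.
  rewrite /dil; apply: cvgD; first exact: cvg_cst.
  apply: cvgM; first exact: cvg_cst.
  by apply: cvgB; [exact: cvg_id | exact: cvg_cst].
- by move=> _ [x Kx <-]; apply: dil_in => //; exact: KO.
- move=> x Kx; apply: K0 => Kl; apply: Kx; exists (c + l^-1 * (x - c)) => //.
  by rewrite /dil; field; rewrite gt_eqF.
Qed.

End dilations.

(** * Riemann-Liouville derivatives of test functions *)

Section fractional_integral.
Context {R : realType}.
Local Notation mu := (@lebesgue_measure R).
Variables (a b beta e : R).
Hypotheses (ab : a < b) (beta1 : beta < 1) (e1 : `|e| = 1).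
Implicit Types f : R -> R.

(* e = 1 gives the left-sided integral and e = -1 the right-sided one. *)
Definition frac_int f z : R := \int[mu]_(t in `]0,
    +oo[) (f (z - e * t) * t `^ (- beta)).

(** For z in ]a - 1, b + 1[ and t >= T the point z - e t lies outside ]a, b[. The fractional
    integral then runs over a bounded range. *)
Let T : R := b - a + 1.

Let T0 : 0 < T. Proof. by rewrite addr_gt0 ?subr_gt0. Qed.

Let mT : measurable (`]0, T[%classic : set (measurableTypeR R)).
Proof. exact: measurable_itv. Qed.

Let mTy : measurable (`]0, +oo[%classic : set (measurableTypeR R)).
Proof. exact: measurable_itv. Qed.

Let kernel_int := integrable_powR0 beta1 T0.

Let e_sq : e = 1 \/ e = -1.
Proof.
by have /eqP := e1; rewrite eqr_norml => /andP[/orP[/eqP|/eqP] ? _];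
    [left|right].
Qed.

Let shift_eq0 f (z t : R) : cc_smooth `]a, b[ f -> z \in `](a - 1), (b + 1)[ ->
  T <= t -> f (z - e * t) = 0.
Proof.
move=> [_ [K [_ KO K0]]]; rewrite in_itv/= => /andP[az zb] tT.
apply: K0 => /KO /=; rewrite in_itv/= => /andP[h1 h2].
by move: tT h1 h2; rewrite /T; case: e_sq => ->; lra.
Qed.

Lemma frac_int_trunc f (z : R) : cc_smooth `]a, b[ f -> z \in `](a - 1),
    (b + 1)[ ->
  frac_int f z = \int[mu]_(t in `]0, T[) (f (z - e * t) * t `^ (- beta)).
Proof.
move=> ccf zab.
rewrite /frac_int Rintegral_mkcond [RHS]Rintegral_mkcond;
    apply: eq_Rintegral => t _.
rewrite !patchE; case: ifPn => [/set_mem/=|]; last first.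
  move=> h; rewrite ifF//; apply/negbTE; move: h; apply: contra => /set_mem /=.
  by rewrite in_itv/= => /andP[t0 _]; apply/mem_set; rewrite /= in_itv/= t0.
rewrite in_itv/= andbT => t0; case: ifPn => // tT.
rewrite (shift_eq0 ccf zab) ?mul0r// leNgt; apply/negP => tT'.
by move/negP: tT; apply; apply/mem_set; rewrite /= in_itv/= t0.
Qed.

Let measurable_kernel (D : set R) : measurable_fun D (fun t : R =>
    t `^ (- beta)).
Proof. by apply: measurable_funTS; exact: measurable_powR. Qed.

Let measurable_shift f z (D : set R) : cc_smooth `]a, b[ f ->
  measurable_fun D (fun t => f (z - e * t)).
Proof.
move=> [sf _]; apply: measurable_funTS; apply: continuous_measurable_fun => x.
apply: continuous_comp; last exact: (smooth_on_continuous sf).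
apply: cvgB; first exact: cvg_cst.
by apply: cvgM; [exact: cvg_cst | exact: cvg_id].
Qed.

Lemma frac_int_integrable f (z : R) : cc_smooth `]a, b[ f ->
  mu.-integrable `]0, T[ (EFin \o (fun t => f (z - e * t) * t `^ (- beta))).
Proof.
move=> ccf; have [M fM] := cc_smooth_bounded ccf.
have := integrableM_bounded mT kernel_int
  (@measurable_shift f z _ ccf) (fun t _ => fM (z - e * t)).
by apply: eq_integrable => // t _ /=; rewrite mulrC.
Qed.

Lemma frac_int_integrabley f (z : R) : cc_smooth `]a, b[ f -> z \in `](a - 1),
    (b + 1)[ ->
  mu.-integrable `]0, +oo[ (EFin \o (fun t => f (z - e * t) * t `^ (- beta))).
Proof.
move=> ccf zab.
have : mu.-integrable (`]0, +oo[ `&` `]0, T[) (EFin \o (fun t =>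
    f (z - e * t) * t `^ (- beta))).
  apply: integrableS (frac_int_integrable z ccf) => //; exact: measurableI.
move=> /((integrable_restrict mu mT mTy _).1).
apply: eq_integrable => // t /set_mem /=; rewrite in_itv/= andbT => t0.
rewrite patchE; case: ifPn => // tT.
rewrite (shift_eq0 ccf zab) ?mul0r// leNgt; apply/negP => tT'.
by move/negP: tT; apply; apply/mem_set; rewrite /= in_itv/= t0.
Qed.

(** In the form of [frac_int] the variable z sits in the smooth factor and not in the singular
    kernel. Differentiation under the integral is then dominated by M t^(- beta), where M bounds
    f'. *)
Lemma is_derive_frac_int f (z : R) : cc_smooth `]a, b[ f -> z \in `](a - 1),
    (b + 1)[ ->
  is_derive z 1 (frac_int f) (frac_int (derive1n 1 f) z).
Proof.
move=> ccf zab; have ccf' := cc_smooth_derive1n 1 ccf.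
have [M fM] := cc_smooth_bounded ccf'.
pose k (x t : R) := f (x - e * t) * t `^ (- beta).
have dk (x t : R) : is_derive x 1 (k ^~ t) (derive1n 1 f (x - e * t) * t `^ (-
    beta)).
  have d1 : is_derive x 1 (fun x => x - e * t) 1.
    by have := is_deriveB (is_derive_id x 1) (is_derive_cst (e * t) x 1);
        rewrite subr0.
  have d2 : is_derive (x - e * t) 1 f (derive1n 1 f (x - e * t)).
    by have [sf _] := ccf; exact: (smooth_on_is_derive sf).
  have d3 := is_derive_comp_eq (g := fun x => x - e * t) d2 d1 erefl.
  rewrite /k (_ : (fun x => _) = (fun x => t `^ (- beta) * f (x - e * t)));
      last first.
    by apply/funext => y; rewrite mulrC.
  by apply: (is_deriveZ_eq d3); rewrite mulr1 mulrC.
have M0 : 0 <= M by apply: le_trans (fM 0).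
have p1E (x t : R) : partial1of2 k x t = derive1n 1 f (x - e * t) * t `^ (-
    beta).
  by rewrite partial1of2E; have [_ ->] := dk x t.
have ik (x : R) : mu.-integrable `]0, T[ (EFin \o k x) by exact:
    frac_int_integrable.
have iM : mu.-integrable `]0, T[ (EFin \o (fun t => M * t `^ (- beta))).
  have := integrableZl mT M kernel_int.
  by apply: eq_integrable => // t _ /=; rewrite EFinM.
have zab' : `](a - 1), (b + 1)[%classic z by [].
have M0' t : 0 <= M * t `^ (- beta) by rewrite mulr_ge0 ?powR_ge0.
have kM (x t : R) : `](a - 1), (b + 1)[%classic x -> `]0, T[%classic t ->
    `|partial1of2 k x t| <= M * t `^ (- beta).
  by move=> _ _; rewrite p1E normrM (ger0_norm (powR_ge0 _ _)) ler_wpM2r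
      ?powR_ge0.
have dkk (x t : R) : `](a - 1), (b + 1)[%classic x -> `]0, T[%classic t ->
    derivable (k ^~ t) x 1.
  by move=> _ _; have [] := dk x t.
have d := derivable_under_integral mT zab' (fun x _ => ik x) dkk M0' iM kM.
have dE := differentiation_under_integral mT zab' (fun x _ =>
    ik x) dkk M0' iM kM.
apply: (@eq_on_is_derive _ `](a - 1), (b + 1)[%classic
   (fun x => \int[mu]_(t in `]0, T[) k x t)) => //.
- by move=> y yab; rewrite frac_int_trunc.
- rewrite frac_int_trunc//; apply: DeriveDef; first exact: d.
  rewrite -derive1E dE; apply: eq_Rintegral => t _; exact: p1E.
Qed.

Lemma derive1n_frac_int f n (z : R) : cc_smooth `]a, b[ f -> z \in `](a - 1),
    (b + 1)[ ->
  derive1n n (frac_int f) z = frac_int (derive1n n f) z.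
Proof.
move=> ccf; elim: n z => // n IH z zab; rewrite derive1nS.
have -> : derive1 (derive1n n (frac_int f)) z = derive1 (frac_int (derive1n n
    f)) z.
  by apply: (@derive1n_eq _ `](a - 1), (b + 1)[%classic _ _ 1).
rewrite derive1E; have [_ ->] := is_derive_frac_int (cc_smooth_derive1n n ccf)
    zab.
by [].
Qed.

Lemma frac_int_bounded f : cc_smooth `]a, b[ f ->
  exists M : R, forall z, z \in `](a - 1), (b + 1)[ -> `|frac_int f z| <= M.
Proof.
move=> ccf; have [M fM] := cc_smooth_bounded ccf.
exists (\int[mu]_(t in `]0, T[) (M * t `^ (- beta))) => z zab.
rewrite frac_int_trunc//.
apply: (le_trans (le_normr_Rintegral _ (frac_int_integrable z ccf))) => //.
apply: le_Rintegral => //.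
- exact: (integrable_norm (frac_int_integrable z ccf)).
- have := integrableZl mT M kernel_int.
  by apply: eq_integrable => // t _ /=; rewrite EFinM.
- move=> t _; rewrite normrM (ger0_norm (powR_ge0 _ _)) ler_wpM2r ?powR_ge0//.
Qed.

Lemma frac_int_measurable f : cc_smooth `]a, b[ f ->
  measurable_fun `]a, b[ (frac_int f).
Proof.
move=> ccf; apply: open_continuous_measurable_fun; first exact: itv_open.
move=> z /set_mem /=; rewrite in_itv/= => /andP[az zb].
have zab : z \in `](a - 1), (b + 1)[ by rewrite in_itv/=; lra.
by have [/derivable1_diffP/differentiable_continuous] := is_derive_frac_int ccf
    zab.
Qed.

(** Substitute l t for t: the factor l is the Jacobian and l^(- beta) comes from the homogeneous
    kernel. *)
Lemma frac_int_dil f c l x : cc_smooth `]a, b[ f -> 0 < l ->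
  x \in `](a - 1), (b + 1)[ ->
  frac_int (dil_fun c l f) (dil c l x) = l * l `^ (- beta) * frac_int f x.
Proof.
move=> ccf l0 xab; have ln0 : l != 0 by rewrite gt_eqF.
have m (D : set R) : measurable_fun D (fun t =>
    dil_fun c l f (dil c l x - e * t) * t `^ (- beta)).
  apply: measurable_funM => //.
  apply: measurable_funTS; apply: continuous_measurable_fun => t.
  rewrite /dil_fun.
  rewrite (_ : (fun t => _) = (fun t => f (x - e * (l^-1 * t)))); last first.
    by apply/funext => u; congr f; rewrite /dil; field.
  apply: continuous_comp; last by apply: (smooth_on_continuous ccf.1).
  apply: cvgB; first exact: cvg_cst.
  apply: cvgM; first exact: cvg_cst.
  by apply: cvgM; [exact: cvg_cst | exact: cvg_id].
have := Rintegral_affine 0 ln0 mTy (m _); rewrite /frac_int => ->.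
rewrite (gtr0_norm l0) -[RHS]mulrA; congr (_ * _).
have -> : [set x0 : R | `]0, +oo[%classic (l * x0 + 0)] = `]0, +oo[%classic.
  by apply/seteqP; split => y /=; rewrite !in_itv/= !andbT addr0 pmulr_rgt0.
rewrite -RintegralZl//; last exact: frac_int_integrabley.
apply: eq_Rintegral => t /set_mem /=; rewrite in_itv/= andbT => t0.
rewrite addr0 (powRM _ (ltW l0) (ltW t0)) mulrCA; congr (_ * (_ * _)).
by rewrite /dil_fun /dil; congr f; field.
Qed.

Lemma frac_int_eq0 f (z : R) (D : set R) : (forall x, ~ D x -> f x = 0) ->
  (forall t, 0 < t -> ~ D (z - e * t)) -> frac_int f z = 0.
Proof.
move=> fD zD; rewrite /frac_int /Rintegral integral0_eq// => t /=.
by rewrite in_itv/= andbT => t0; rewrite fD ?mul0r//; exact: zD.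
Qed.

End fractional_integral.

(** * Operators that scale under dilations *)

Section covariant_operators.
Context {R : realType}.
Local Notation mu := (@lebesgue_measure R).
Implicit Types (f : R -> R) (s : side).

(* What the averaging argument uses of the operators [derive1n k] (gam = k) and
   [RL_deriv] (gam = alpha).  In the last clause the point z lies beyond the image
   of (a, b) under the contraction: there the center c has to match the side. *)
Definition dilation_covariant (a b c gam : R) (T : (R -> R) -> R -> R) :=
  forall f, cc_smooth `]a, b[ f ->
  [/\ measurable_fun `]a, b[ (T f),
      exists M : R, forall x, x \in `]a, b[ -> `|T f x| <= M,
      forall l x, 0 < l -> l < 1 -> x \in `]a, b[ ->
        T (dil_fun c l f) (dil c l x) = l `^ (- gam) * T f x &
      forall l z, 0 < l -> l < 1 -> z \in `]a, b[ ->
        c + l^-1 * (z - c) \notin `]a, b[ -> T (dil_fun c l f) z = 0].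

Lemma derive1n_covariant (a b c : R) k : a <= c <= b ->
  dilation_covariant a b c k%:R (derive1n k).
Proof.
move=> acb f ccf; have cck := cc_smooth_derive1n k ccf; split.
- exact: cc_smooth_measurable cck.
- by have [M fM] := cc_smooth_bounded cck; exists M => x _.
- move=> l x l0 l1 xab; rewrite derive1n_dil_fun; last by case: ccf.
  by rewrite dilK ?gt_eqF// powR_invn ?ltW// exprVn.
- move=> l z l0 l1 zab h; rewrite derive1n_dil_fun; last by case: ccf.
  have [_ [K [_ KO K0]]] := cck; rewrite K0 ?mulr0// => /KO.
  by apply/negP.
Qed.

Definition side_center (a b : R) s := match s with left_side =>
    a | right_side => b end.

Definition side_sign s : R := match s with left_side => 1 | right_side =>
    -1 end.

Lemma side_signN s : `|side_sign s| = 1.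
Proof. by case: s; rewrite /= ?normrN normr1. Qed.

Definition RL_const s (alpha : R) : R :=
  let n := (Num.truncn alpha).+1 in
  match s with left_side => (Gamma (n%:R - alpha))^-1
             | right_side => (-1) ^+ n / Gamma (n%:R - alpha) end.

Lemma RL_exponent_lt1 (alpha : R) : 0 < alpha ->
    alpha - (Num.truncn alpha).+1%:R + 1 < 1.
Proof.
by move=> a0; have := truncnS_gt alpha; lra.
Qed.

(** The substitution y = z - e t turns the kernel of the definition into that of [frac_int], and the
    n outer derivatives then fall on f. For compactly supported f the Riemann-Liouville and Caputo
    forms agree. *)
Lemma RL_derivE (a b alpha : R) s f x : a < b -> 0 < alpha ->
    cc_smooth `]a, b[ f ->
  x \in `]a, b[ ->
  RL_deriv s alpha f x = RL_const s alpha *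
    frac_int (alpha - (Num.truncn alpha).+1%:R + 1) (side_sign s)
      (derive1n (Num.truncn alpha).+1 f) x.
Proof.
move=> ab alpha0 ccf; rewrite in_itv/= => /andP[ax xb].
have xab : x \in `](a - 1), (b + 1)[ by rewrite in_itv/=; lra.
have H := derive1n_frac_int ab (RL_exponent_lt1 alpha0) (side_signN s)
    (Num.truncn alpha).+1 ccf xab.
rewrite -[X in _ = _ * X]H {H}.
have mf (D : set R) : measurable_fun D f := @cc_smooth_measurable R _ _ D ccf.
have mp (c d r : R) (D : set R) : measurable_fun D (fun t : R =>
    (c * t + d) `^ r).
  apply: measurable_funTS; apply: (measurableT_comp (measurable_powR r)).
  by apply: measurable_funD => //; exact: measurable_funM.
set beta := alpha - (Num.truncn alpha).+1%:R + 1.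
have m1 : (-1 : R) != 0 by rewrite lt_eqF ?ltrN10.
case: s.
- have H z : \int[mu]_(y in `]-oo, z[) (f y / (z - y) `^ beta) = frac_int beta
    1 f z.
    transitivity (\int[mu]_(y in `]-oo, z[) (f y * (-1 * y + z) `^ (- beta))).
      by apply: eq_Rintegral => y _; rewrite powRN mulN1r [- y + _]addrC.
    rewrite [LHS](Rintegral_affine z m1 (measurable_itv _)
      (measurable_funM (mf _) (mp (-1) z _ _))).
    rewrite normrN1 mul1r.
    have -> : [set x | `]-oo, z[%classic (-1 * x + z)] = `]0, +oo[%classic.
      by apply/seteqP; split => y /=; rewrite !in_itv/= andbT mulN1r gtrDr
          oppr_lt0.
    by apply: eq_Rintegral => t _; congr (f _ * _ `^ _); ring.
  by rewrite /RL_deriv (funext H).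
- have H z : \int[mu]_(y in `]z, +oo[) (f y / (y - z) `^ beta) = frac_int beta
    (-1) f z.
    transitivity (\int[mu]_(y in `]z, +oo[) (f y * (1 * y + - z) `^ (- beta))).
      by apply: eq_Rintegral => y _; rewrite powRN mul1r.
    rewrite [LHS](Rintegral_affine z (oner_neq0 _) (measurable_itv _)
      (measurable_funM (mf _) (mp 1 (- z) _ _))).
    rewrite normr1 mul1r.
    have -> : [set x | `]z, +oo[%classic (1 * x + z)] = `]0, +oo[%classic.
      by apply/seteqP; split => y /=; rewrite !in_itv/= !andbT mul1r ltrDr.
    by apply: eq_Rintegral => t _; congr (f _ * _ `^ _); ring.
  by rewrite /RL_deriv (funext H).
Qed.

(** The n derivatives contribute l^(- n) and the fractional integral l^(1 - beta) with beta = alpha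
    - n + 1, which gives l^(- alpha) in all. For the vanishing clause, the opposite-sided integral
    at z reads the function only at points farther from c than z, and these are beyond the
    transported support as soon as z is. *)
Lemma RL_covariant (a b alpha : R) s : a < b -> 0 < alpha ->
  dilation_covariant a b (side_center a b s) alpha (RL_deriv (opposite s)
      alpha).
Proof.
move=> ab alpha0 f ccf; set n := (Num.truncn alpha).+1;
    set c := side_center a b s.
have be1 := RL_exponent_lt1 alpha0; have e1 := side_signN (opposite s).
have ccn := cc_smooth_derive1n n ccf.
have acb : a <= c <= b by rewrite /c; case: (s); rewrite /= lexx ltW.
have wide x : x \in `]a, b[ -> x \in `](a - 1), (b + 1)[.
  by rewrite !in_itv/= => /andP[? ?]; lra.
have dilE l z : 0 < l -> l < 1 -> z \in `]a, b[ ->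
    RL_deriv (opposite s) alpha (dil_fun c l f) z = RL_const (opposite s) alpha
        *
    (l^-1 ^+ n * frac_int (alpha - n%:R + 1) (side_sign (opposite s)) (dil_fun
        c l (derive1n n f)) z).
  move=> l0 l1 zab; rewrite (RL_derivE _ ab alpha0 (dil_fun_cc_smooth acb l0
      (ltW l1) ccf) zab).
  congr (_ * _); rewrite -RintegralZl//; last first.
    apply: frac_int_integrabley; [exact: ab|exact: be1|exact: e1| |exact: wide].
    exact: (dil_fun_cc_smooth acb l0 (ltW l1) ccn).
  apply: eq_Rintegral => t _; rewrite mulrA; congr (_ * _).
  by rewrite derive1n_dil_fun//; case: ccf.
split.
- apply: (eq_measurable_fun (fun x => RL_const (opposite s) alpha *
    frac_int (alpha - n%:R + 1) (side_sign (opposite s)) (derive1n n f) x)).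
    by move=> x /set_mem xab; rewrite (RL_derivE _ ab alpha0 ccf).
  by apply: measurable_funM => //; exact: (frac_int_measurable ab be1 e1 ccn).
- have [M fM] := frac_int_bounded ab be1 e1 ccn.
  exists (`|RL_const (opposite s) alpha| * M) => x xab.
  rewrite (RL_derivE _ ab alpha0 ccf)// normrM ler_wpM2l//; apply: fM;
      exact: wide.
- move=> l x l0 l1 xab; rewrite (dilE l _ l0 l1 (dil_in acb l0 (ltW l1) xab)).
  rewrite (RL_derivE _ ab alpha0 ccf xab) (frac_int_dil ab be1 e1 c ccn l0
      (wide _ xab)).
  rewrite [RHS]mulrCA; congr (_ * _); rewrite !mulrA; congr (_ * _).
  have ln0 : l != 0 by rewrite gt_eqF.
  rewrite exprVn -powR_invn ?ltW// -{2}(powRr1 (ltW l0)) -!powRD ?ln0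
      ?implybT//.
  by rewrite /n; congr (_ `^ _); ring.
- move=> l z l0 l1 zab zn; rewrite (dilE l z l0 l1 zab).
  rewrite (@frac_int_eq0 _ _ _ _ z [set y | c + l^-1 * (y - c) \in `]a, b[])
      ?mulr0//.
    by move=> y /= yn; have [_ [K [_ KO K0]]] := ccn; apply: K0 => /KO.
  move=> t t0 /=; move: zab zn; rewrite !in_itv/= =>
      /andP[az zb] zn /andP[h1 h2].
  move: zn; rewrite negb_and -!leNgt.
  have li : 1 < l^-1 by rewrite invf_gt1.
  move: h1 h2; rewrite /c; case: (s) => /= h1 h2 /orP[h|h]; nra.
Qed.

End covariant_operators.

(** * Averages over dilations *)

Section jensen.
Context d (T : measurableType d) {R : realType} (mu : {measure set T ->
    \bar R}).

(** The tangent inequality for the convex power p, obtained from Young's inequality for t and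
    m^(p-1) with conjugate exponent q = p / (p - 1). The case p = 1, where q is meaningless, is set
    apart. *)
Lemma powR_tangent (p m t : R) : 1 <= p -> 0 < m -> 0 <= t ->
  m `^ p + p * m `^ (p - 1) * (t - m) <= t `^ p.
Proof.
move=> p1 m0 t0; have p0 : 0 < p by rewrite (lt_le_trans _ p1).
have mp : m `^ p = m * m `^ (p - 1) by rewrite mulr_powRB1// ltW.
move: p1; rewrite le_eqVlt => /predU1P[<-|p1].
  by rewrite subrr powRr0 !powRr1 ?(ltW m0)//; lra.
pose q := p / (p - 1).
have pm0 : 0 < p - 1 by rewrite subr_gt0.
have q0 : 0 < q by rewrite divr_gt0.
have pq : p^-1 + q^-1 = 1 by rewrite /q invf_div; field; rewrite gt_eqF.
have := @conjugate_powR R t (m `^ (p - 1)) p q t0 (powR_ge0 _ _) p0 q0 pq.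
rewrite -powRrM (_ : (p - 1) * q = p); last by rewrite /q; field;
    rewrite gt_eqF.
move=> h; have h2 : p * (t * m `^ (p - 1)) <= t `^ p + (p - 1) * m `^ p.
  have := ler_wpM2l (ltW p0) h; rewrite mulrDr [p * (t `^ p / p)]mulrCA divff
      ?gt_eqF// mulr1.
  by rewrite (_ : p * (m `^ p / q) = (p - 1) * m `^ p)// /q; field;
      rewrite !gt_eqF.
rewrite mp in h2 *; nra.
Qed.

(** The tangent inequality at the mean [m] of |g| is integrated against the density k, so that the
    linear term cancels. A zero mean and an infinite right-hand side are disposed of first. *)
Lemma jensen_powR (D : set T) (k g : T -> R) (p : R) : 1 <= p -> measurable D ->
  (forall x, D x -> 0 <= k x) ->
  mu.-integrable D (EFin \o k) -> \int[mu]_(x in D) k x = 1 ->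
  measurable_fun D g ->
  mu.-integrable D (EFin \o (fun x => k x * g x)) ->
  ((`|\int[mu]_(x in D) (k x * g x)| `^ p)%:E <=
   \int[mu]_(x in D) (k x * `|g x| `^ p)%:E)%E.
Proof.
move=> p1 mD k0 ik k1 mg ikg; have p0 : 0 < p by rewrite (lt_le_trans _ p1).
have mk : measurable_fun D k by case/integrableP : ik => /measurable_EFinP.
have ikn : mu.-integrable D (EFin \o (fun x => k x * `|g x|)).
  have := integrable_norm ikg; apply: eq_integrable => // x /set_mem Dx /=.
  by rewrite normrM (ger0_norm (k0 _ Dx)).
set m := \int[mu]_(x in D) (k x * `|g x|).
have m0 : 0 <= m by apply: Rintegral_ge0 => x Dx; rewrite mulr_ge0// k0.
have hm : `|\int[mu]_(x in D) (k x * g x)| <= m.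
  apply: (le_trans (le_normr_Rintegral mD ikg)).
  rewrite (@eq_Rintegral _ _ _ mu _ (fun x => k x * `|g x|))// => x /set_mem Dx.
  by rewrite normrM (ger0_norm (k0 _ Dx)).
have : ((`|\int[mu]_(x in D) (k x * g x)| `^ p)%:E <= (m `^ p)%:E)%E.
  by rewrite lee_fin ge0_ler_powR// ltW.
move=> /le_trans; apply.
have kgp x : D x -> (0 <= (k x * `|g x| `^ p)%:E)%E.
  by move=> Dx; rewrite lee_fin mulr_ge0 ?k0// powR_ge0.
move: m0; rewrite le_eqVlt => /predU1P[<-|m0].
  by rewrite powR0 ?gt_eqF//; apply: integral_ge0.
have [E|] := eqVneq (\int[mu]_(x in D) (k x * `|g x| `^ p)%:E)%E +oo%E;
    first by rewrite E leey.
rewrite -ltey => fin.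
have mgp : measurable_fun D (fun x => k x * `|g x| `^ p).
  apply: measurable_funM => //; apply: (measurableT_comp (measurable_powR p)).
  exact: measurableT_comp.
have igp : mu.-integrable D (EFin \o (fun x => k x * `|g x| `^ p)).
  apply/integrableP; split; first exact/measurable_EFinP.
  rewrite (le_lt_trans _ fin)//; apply: ge0_le_integral => //.
  - by apply/measurable_EFinP; exact: measurableT_comp.
  - exact/measurable_EFinP.
  - by move=> x Dx; rewrite /= ger0_norm// -lee_fin kgp.
rewrite -(fineK (integrable_fin_num mD igp)) lee_fin -/(Rintegral mu D (fun x
    => k x * `|g x| `^ p)).
pose c := p * m `^ (p - 1).
have iL : mu.-integrable D (EFin \o (fun x =>
    (m `^ p - c * m) * k x + c * (k x * `|g x|))).
  have := integrableD mD (integrableZl mD (m `^ p - c * m) ik) (integrableZl mD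
      c ikn).
  by apply: eq_integrable.
have : \int[mu]_(x in D) ((m `^ p - c * m) * k x + c * (k x * `|g x|)) <=
       \int[mu]_(x in D) (k x * `|g x| `^ p).
  apply: le_Rintegral => // x Dx.
  have h := powR_tangent p1 m0 (normr_ge0 (g x)).
  rewrite -/c in h; have := ler_wpM2l (k0 x Dx) h; rewrite mulrDr; lra.
apply: le_trans.
rewrite RintegralD//; last 2 first.
- by have := integrableZl mD (m `^ p - c * m) ik; apply: eq_integrable.
- by have := integrableZl mD c ikn; apply: eq_integrable.
by rewrite !RintegralZl// k1 -/m; lra.
Qed.

End jensen.

Section averages.
Context {R : realType}.
Local Notation mu := (@lebesgue_measure R).
Variables (a b c : R).
Hypotheses (ab : a < b) (hc : c = a \/ c = b).
Implicit Types (u v w k psi : R -> R).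

Definition avg k u x : R := \int[mu]_(l in `]0, 1[) (k l * u (dil c l x)).

(** A positive l0 keeps the Jacobian 1/l bounded, and l1 < 1 leaves only strict contractions.
    Neither sign nor mass is prescribed, so the weighted kernels k(l) l^gam belong to the same
    class. *)
Definition dil_kernel l0 l1 B k :=
  [/\ 0 < l0, l1 < 1, measurable_fun setT k, forall l, `|k l| <= B &
      forall l, l \notin `[l0, l1] -> k l = 0].

Let mJ : measurable (`]0, 1[%classic : set (measurableTypeR R)).
Proof. exact: measurable_itv. Qed.

Let mO : measurable (`]a, b[%classic : set (measurableTypeR R)).
Proof. exact: measurable_itv. Qed.

Let acb : a <= c <= b.
Proof. by case: hc => ->; rewrite lexx ltW. Qed.

Lemma center_neq x : x \in `]a, b[ -> x - c != 0.
Proof.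
rewrite in_itv/= subr_eq0 => /andP[ax xb].
by case: hc => ->; rewrite ?(gt_eqF ax) ?(lt_eqF xb).
Qed.

(** For fixed x the orbit is affine in l with slope x - c, nonzero because c is an endpoint.
    Averages therefore converge at every x, not merely almost everywhere. *)
Lemma dil_orbit_integrable w x : mu.-integrable `]a, b[ (EFin \o w) ->
    x \in `]a, b[ ->
  mu.-integrable `]0, 1[ (EFin \o (fun l => w (dil c l x))).
Proof.
move=> iw xab.
have := integrable_affine c (center_neq xab) (measurable_itv _) iw.
rewrite (_ : (fun l => w (dil c l x)) = (fun l => w ((x - c) * l + c)));
    last first.
  by apply/funext => l; rewrite /dil addrC mulrC.
apply: integrableS; [|exact: measurable_itv|].
  exact: (@measurable_preimage_affine _ (x - c) c `]a, b[%classic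
      (measurable_itv _)).
move=> l /=; rewrite in_itv/= => /andP[l0 l1].
by rewrite addrC mulrC; apply: (dil_in acb l0 (ltW l1)).
Qed.

Lemma avg_integrand_integrable l0 l1 B k w x : dil_kernel l0 l1 B k ->
  mu.-integrable `]a, b[ (EFin \o w) -> x \in `]a, b[ ->
  mu.-integrable `]0, 1[ (EFin \o (fun l => k l * w (dil c l x))).
Proof.
move=> [l00 l11 mk kB k0] iw xab.
have := integrableM_bounded mJ (dil_orbit_integrable iw xab)
  (measurable_funTS mk) (fun l _ => kB l).
by apply: eq_integrable => // l _ /=; rewrite mulrC.
Qed.

(** The pair is (x, l). Extension by zero makes the integrand a function on the whole plane, where
    measurability and Fubini need no domain bookkeeping. *)
Definition dil_integrand k w psi (z : measurableTypeR R * measurableTypeR R) :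
    R :=
  k z.2 * (w \_ `]a, b[) (dil c z.2 z.1) * (psi \_ `]a, b[) z.1.

Let measurable_ext w : measurable_fun `]a, b[ w ->
    measurable_fun setT (w \_ `]a, b[).
Proof. exact: (measurable_restrictT _ mO).1. Qed.

Lemma dil_integrand_measurable l0 l1 B k w psi : dil_kernel l0 l1 B k ->
  measurable_fun `]a, b[ w -> measurable_fun `]a, b[ psi ->
  measurable_fun setT (dil_integrand k w psi).
Proof.
move=> [_ _ mk _ _] mw mpsi.
apply: measurable_funM; last first.
  exact: (measurableT_comp (measurable_ext mpsi) measurable_fst).
apply: measurable_funM; first exact: (measurableT_comp mk measurable_snd).
have mw' := measurable_ext mw.
apply: (measurableT_comp mw').
rewrite /dil; apply: measurable_funD => //.
apply: measurable_funM; first exact: measurable_snd.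
by apply: measurable_funD => //; exact: measurable_fst.
Qed.

Lemma integral_dil_abs w l : measurable_fun `]a, b[ w -> 0 < l ->
  (\int[mu]_x `|(w \_ `]a, b[) (dil c l x)|%:E =
   l^-1%:E * \int[mu]_(x in `]a, b[) `|w x|%:E)%E.
Proof.
move=> mw l0; have ln0 : l != 0 by rewrite gt_eqF.
have mw' := measurable_ext mw.
have -> : (\int[mu]_(x in `]a, b[) `|w x|%:E = \int[mu]_x `|(w \_ `]a, b[)
    x|%:E)%E.
  rewrite integral_mkcond; apply: eq_integral => x _.
  by rewrite !patchE; case: ifPn => //; rewrite normr0.
rewrite [X in _ = (_ * X)%E](ge0_integral_affine (c - l * c) ln0
    measurableT)//; last first.
  by apply/measurable_EFinP; exact: measurableT_comp.
rewrite gtr0_norm// muleA -EFinM mulVf// mul1e.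
by apply: eq_integral => x _; rewrite dilE.
Qed.

(** Tonelli with the x-integral inside: it is at most B M / l0 times the L^1 norm of w for l in
    [l0, l1], and zero for other l. *)
Lemma dil_integrand_integrable l0 l1 B M k w psi : dil_kernel l0 l1 B k ->
  mu.-integrable `]a, b[ (EFin \o w) -> measurable_fun `]a, b[ psi ->
  (forall x, x \in `]a, b[ -> `|psi x| <= M) ->
  (mu \x mu)%E.-integrable setT (EFin \o dil_integrand k w psi).
Proof.
move=> hk iw mpsi psiM; have [l00 l11 mk kB k0] := hk.
have mw : measurable_fun `]a, b[ w by case/integrableP : iw =>
    /measurable_EFinP.
have mw' := measurable_ext mw.
have mH := dil_integrand_measurable hk mw mpsi.
apply/(@integrable21ltyP _ _ _ _ _ mu mu); first exact/measurable_EFinP.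
have B0 : 0 <= B by apply: le_trans (kB 0).
(* Some point of the interval is needed to see that [M] is nonnegative. *)
have mid : (a + b) / 2 \in `]a, b[ by rewrite in_itv/=; apply/andP; split;
    move: ab; lra.
have M0 : 0 <= M by apply: le_trans (psiM _ mid).
pose W := fine (\int[mu]_(x in `]a, b[) `|w x|%:E)%E.
have WE : (\int[mu]_(x in `]a, b[) `|w x|%:E)%E = W%:E.
  rewrite fineK// ge0_fin_numE; last exact: integral_ge0.
  by case/integrableP : iw.
have W0 : 0 <= W by rewrite -lee_fin -WE; apply: integral_ge0.
have bnd l : (\int[mu]_x `|(dil_integrand k w psi (x, l))%:E| <=
    (B * M * l0^-1 * W * \1_(`[l0, l1]%classic) l)%:E)%E.
  rewrite indicE; case: (boolP (l \in `[l0, l1])) => ll; last first.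
    rewrite integral0_eq ?lee_fin; last first.
      by move=> x _; rewrite /dil_integrand /= k0// !mul0r normr0.
    rewrite (_ : (l \in _) = false) ?mulr0//.
    by apply/negbTE/negP => /set_mem/=; apply/negP.
  rewrite mem_set// mulr1.
  have l_gt0 : 0 < l by move: ll; rewrite in_itv/= => /andP[/(lt_le_trans l00)].
  apply: (@le_trans _ _ (\int[mu]_x ((B * M)%:E * `|(w \_ `]a, b[) (dil c l
      x)|%:E))%E).
    apply: ge0_le_integral => //.
    - apply: measurableT_comp => //; apply/measurable_EFinP.
      exact: (measurableT_comp mH (measurable_pair2 l)).
    - apply: measurable_funeM; apply/measurable_EFinP;
        apply: measurableT_comp => //.
      apply: (measurableT_comp mw'); rewrite (_ : dil c l = (fun x =>
          l * x + (c - l * c))).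
        exact: measurable_affine.
      by apply/funext => y; rewrite dilE.
    - move=> x _; rewrite -EFinM lee_fin /dil_integrand /= !normrM.
      rewrite -mulrA [`|(w \_ _) _| * _]mulrC mulrA ler_wpM2r//.
      apply: ler_pM => //; rewrite patchE; case: ifPn => [/set_mem/psiM//|_].
      by rewrite normr0.
  rewrite ge0_integralZl//; last 2 first.
  - by apply/measurable_EFinP; apply: measurableT_comp => //;
      apply: (measurableT_comp mw');
      rewrite (_ : dil c l = (fun x => l * x + (c - l * c)));
          [exact: measurable_affine|apply/funext => y; rewrite dilE].
  - by rewrite lee_fin mulr_ge0.
  rewrite integral_dil_abs// WE -!EFinM lee_fin !mulrA ler_wpM2r// ler_wpM2l
      ?mulr_ge0//.
  rewrite lef_pV2 ?posrE//; by move: ll; rewrite in_itv/= => /andP[].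
apply: (@le_lt_trans _ _ (\int[mu]_l (B * M * l0^-1 * W *
    \1_(`[l0, l1]%classic) l)%:E)%E).
  apply: ge0_le_integral => //.
  - by move=> l _; apply: integral_ge0.
  - apply: (@measurable_fun_fubini_tonelli_G _ _ _ _ _ mu
      (abse \o (EFin \o dil_integrand k w psi))).
      by apply: measurableT_comp => //; exact/measurable_EFinP.
    by move=> z /=.
  - by apply/measurable_EFinP; apply: measurable_funM => //;
      apply: measurable_indic; exact: measurable_itv.
  - by move=> l _; exact: bnd.
under eq_integral do rewrite EFinM.
rewrite ge0_integralZl; [|exact: measurableT| | |]; last 3 first.
- by apply/measurable_EFinP; apply: measurable_indic; exact: measurable_itv.
- by move=> l _; rewrite lee_fin indicE.
- by rewrite lee_fin !mulr_ge0// invr_ge0 ltW.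
rewrite integral_indic; [|exact: measurableT|exact: measurable_itv].
rewrite setIT; apply: lte_mul_pinfty => //.
- by rewrite lee_fin !mulr_ge0// invr_ge0 ltW.
- by apply: compact_finite_measure; exact: segment_compact.
Qed.

Lemma dil_integrand_avg l0 l1 B k w psi x : dil_kernel l0 l1 B k ->
  mu.-integrable `]a, b[ (EFin \o w) ->
  (\int[mu]_l (dil_integrand k w psi (x, l))%:E)%E =
  ((fun x => avg k w x * psi x) \_ `]a, b[ x)%:E.
Proof.
move=> hk iw; have [l00 l11 mk kB k0] := hk.
rewrite patchE; case: ifPn => [/set_mem/= xab|xab]; last first.
  rewrite integral0_eq// => l _.
  by rewrite /dil_integrand /= [X in _ * X]patchE (negbTE xab) mulr0.
have ik := avg_integrand_integrable hk iw xab.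
have iH : mu.-integrable `]0, 1[ (EFin \o (fun l =>
    k l * w (dil c l x) * psi x)).
  have := integrableZl mJ (psi x) ik; apply: eq_integrable => // l _ /=.
  by rewrite -EFinM mulrC.
rewrite /avg -RintegralZr// /Rintegral fineK; last exact: integrable_fin_num.
rewrite [RHS]integral_mkcond; apply: eq_integral => l _.
rewrite [RHS]patchE /dil_integrand /=; case: ifPn => lJ.
  have lJ' : l \in `]0, 1[ := set_mem lJ.
  move: lJ'; rewrite in_itv/= => /andP[lp /ltW lq].
  by rewrite !patchE !mem_set//; exact: (dil_in acb lp lq).
rewrite k0 ?mul0r//; apply: contra lJ; rewrite in_itv/= => /andP[h1 h2].
by apply: mem_set; rewrite /= in_itv/= (lt_le_trans l00)// (le_lt_trans h2).
Qed.

Lemma avg_measurable l0 l1 B k w : dil_kernel l0 l1 B k ->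
  mu.-integrable `]a, b[ (EFin \o w) -> measurable_fun `]a, b[ (avg k w).
Proof.
move=> hk iw.
have iH : (mu \x mu)%E.-integrable setT (EFin \o dil_integrand k w (cst 1)).
  by apply: (dil_integrand_integrable (M := 1) hk iw) => // x _; rewrite normr1.
apply/(measurable_restrictT _ mO)/measurable_EFinP.
have := measurable_fubini_F iH; apply: eq_measurable_fun => x _.
rewrite /fubini_F /= (dil_integrand_avg _ _ hk iw); congr (EFin _).
by rewrite !patchE /cst mulr1.
Qed.

(** By Fubini, pairing with an average is averaging the pairings. This lets each l be treated
    separately. *)
Lemma avg_pairing l0 l1 B M k w psi : dil_kernel l0 l1 B k ->
  mu.-integrable `]a, b[ (EFin \o w) -> measurable_fun `]a, b[ psi ->
  (forall x, x \in `]a, b[ -> `|psi x| <= M) ->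
  mu.-integrable `]a, b[ (EFin \o (fun x => avg k w x * psi x)) /\
  \int[mu]_(x in `]a, b[) (avg k w x * psi x) =
  fine (\int[mu]_l (k l * \int[mu]_(x in `]a, b[) (w (dil c l x) * psi
      x))%:E)%E.
Proof.
move=> hk iw mpsi psiM; have iH := dil_integrand_integrable hk iw mpsi psiM.
have [l00 l11 mk kB k0] := hk.
split.
  apply/(integrable_mkcond _ mO); rewrite restrict_EFin.
  have := integrable_fubini_F iH; apply: eq_integrable => // x _.
  by rewrite /fubini_F /= (dil_integrand_avg _ _ hk iw).
rewrite Rintegral_mkcond /Rintegral; congr fine.
under eq_integral do rewrite -(dil_integrand_avg _ _ hk iw).
rewrite (Fubini iH); apply: eq_integral => l _.
have [ll|ll] := boolP (l \in `[l0, l1]); last first.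
  rewrite k0// mul0r integral0_eq// => x _.
  by rewrite /dil_integrand /= k0// !mul0r.
have l_gt0 : 0 < l by move: ll; rewrite in_itv/= => /andP[/(lt_le_trans l00)].
have l_lt1 : l < 1 by move: ll; rewrite in_itv/= => /andP[_ /le_lt_trans];
    apply.
have mw : measurable_fun `]a, b[ w by case/integrableP : iw =>
    /measurable_EFinP.
have dO x : x \in `]a, b[ -> dil c l x \in `]a, b[ by apply: (dil_in acb l_gt0
    (ltW l_lt1)).
have iwl : mu.-integrable `]a, b[ (EFin \o (fun x => w (dil c l x))).
  have h := integrable_affine (c - l * c) (lt0r_neq0 l_gt0) mO iw.
  rewrite (_ : (fun x => w (dil c l x)) = (fun x => w (l * x + (c - l * c))));
      last first.
    by apply/funext => x; rewrite dilE.
  apply: integrableS h; [|exact: mO|].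
    exact: (@measurable_preimage_affine _ l (c - l * c) `]a, b[%classic
        (measurable_itv _)).
  by move=> x /= xab; rewrite -dilE; exact: dO.
have i2 := integrableM_bounded mO iwl mpsi psiM.
rewrite EFinM -(fineK (integrable_fin_num mO i2)) -?EFinM.
rewrite -[fine _]/(\int[mu]_(x in `]a, b[) (w (dil c l x) * psi x)).
rewrite /Rintegral EFinM fineK; last exact: integrable_fin_num.
rewrite -integralZl//.
rewrite [RHS]integral_mkcond; apply: eq_integral => x _.
rewrite [RHS]patchE /dil_integrand /=; case: ifPn => xab.
  have d1 : dil c l x \in `]a, b[%classic by apply/mem_set/dO;
      exact: set_mem xab.
  by rewrite !patchE xab d1 -EFinM mulrA.
by rewrite [X in _ * X]patchE (negbTE xab) mulr0.
Qed.

End averages.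

(** * Weak derivatives of averages *)

Section average_of_weak_derivative.
Context {R : realType}.
Local Notation mu := (@lebesgue_measure R).
Variables (a b c : R).
Hypotheses (ab : a < b) (hc : c = a \/ c = b).
Implicit Types (u v w k f : R -> R).

Let mO : measurable (`]a, b[%classic : set (measurableTypeR R)).
Proof. exact: measurable_itv. Qed.

Let acb : a <= c <= b.
Proof. by case: hc => ->; rewrite lexx ltW. Qed.

Lemma dil_kernel_powR l0 l1 B k gam : 0 <= gam -> dil_kernel l0 l1 B k ->
  dil_kernel l0 l1 B (fun l => k l * l `^ gam).
Proof.
move=> gam0 [l00 l11 mk kB k0]; split=> //.
- by apply: measurable_funM => //; exact: measurable_powR.
- move=> l; have [ll|ll] := boolP (l \in `[l0, l1]); last first.
    by rewrite k0// mul0r normr0 (le_trans _ (kB 0)).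
  rewrite normrM -[B]mulr1 ler_pM//.
  have l_gt0 : 0 < l by move: ll; rewrite in_itv/= => /andP[/(lt_le_trans l00)].
  have l_lt1 : l < 1 by move: ll; rewrite in_itv/= => /andP[_ /le_lt_trans];
      apply.
  rewrite ger0_norm ?powR_ge0//.
  have := @ge0_ler_powR R gam gam0 l 1; rewrite !nnegrE powR1; apply => //;
      exact: ltW.
- by move=> l ll; rewrite k0// mul0r.
Qed.

(** After the substitution z = tau_l x the integral runs over tau_l (a, b) only. The vanishing
    clause of [dilation_covariant] extends it to the whole interval. The factor 1/l is the Jacobian,
    and l^gam undoes the scaling of T. *)
Lemma pairing_dil (gam : R) (T : (R -> R) -> R -> R) w f l :
  dilation_covariant a b c gam T -> cc_smooth `]a, b[ f -> 0 < l -> l < 1 ->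
  mu.-integrable `]a, b[ (EFin \o w) ->
  \int[mu]_(x in `]a, b[) (w (dil c l x) * T f x) =
  l `^ gam * l^-1 * \int[mu]_(x in `]a, b[) (w x * T (dil_fun c l f) x).
Proof.
move=> covT ccf l0 l1 iw; have ln0 : l != 0 by rewrite gt_eqF.
have mw : measurable_fun `]a, b[ w by case/integrableP : iw =>
    /measurable_EFinP.
have ccl := dil_fun_cc_smooth acb l0 (ltW l1) ccf.
have [mTl _ _ _] := covT _ ccl.
have [_ [M TM] Tdil T0] := covT _ ccf.
have [mT _ _ _] := covT _ ccf.
have E := Rintegral_affine (c - l * c) ln0 mO (measurable_funM mw mTl).
rewrite [X in _ = _ * X]E gtr0_norm// !mulrA mulfVK//.
rewrite -RintegralZl//; last 2 first.
- exact: (@measurable_preimage_affine _ l (c - l * c) `]a, b[%classic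
    (measurable_itv _)).
- apply: integrable_affine => //.
  have [_ [N TN] _ _] := covT _ ccl.
  exact: (integrableM_bounded mO iw mTl TN).
rewrite Rintegral_mkcond [RHS]Rintegral_mkcond; apply: eq_Rintegral => x _.
have lgam : l `^ gam * l `^ (- gam) = 1.
  by rewrite powRN mulfV// powR_eq0 negb_and ln0.
rewrite !patchE; case: ifPn => [/set_mem/= xab|xab].
  have dab := dil_in acb l0 (ltW l1) xab.
  rewrite mem_set/=; last by rewrite -dilE.
  rewrite -dilE Tdil// -[LHS]mul1r -lgam; ring.
(* Here x is outside the interval while tau_l x is inside it, so T of the transported function
   vanishes at tau_l x. *)
case: ifPn => // /set_mem/= dab; rewrite -dilE in dab *.
rewrite T0 ?mulr0//; rewrite dilK//; move: xab; rewrite notin_setE /=.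
by move/negP.
Qed.

(** For each l both sides reduce to the pairing of u with T of the transported test function. The u
    side picks up l^gam / l and the v side only 1/l, which is why the kernel for v carries the
    weight l^gam. *)
Lemma avg_weak (gam sg B l0 l1 : R) (T : (R -> R) -> R -> R) k u v : 0 <= gam ->
  dilation_covariant a b c gam T -> dil_kernel l0 l1 B k ->
  mu.-integrable `]a, b[ (EFin \o u) -> mu.-integrable `]a, b[ (EFin \o v) ->
  (forall f, cc_smooth `]a, b[ f -> \int[mu]_(x in `]a, b[) (v x * f x) =
     sg * \int[mu]_(x in `]a, b[) (u x * T f x)) ->
  forall f, cc_smooth `]a, b[ f ->
    \int[mu]_(x in `]a, b[) (avg c (fun l => k l * l `^ gam) v x * f x) =
    sg * \int[mu]_(x in `]a, b[) (avg c k u x * T f x).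
Proof.
move=> gam0 covT hk iu iv uv f ccf; have [l00 l11 mk kB k0] := hk.
have hkg := dil_kernel_powR gam0 hk.
have [M fM] := cc_smooth_bounded ccf.
have [mT [N TN] _ _] := covT _ ccf.
have mf : measurable_fun `]a, b[ f by exact: cc_smooth_measurable ccf.
have [_ ->] := avg_pairing ab hc hkg iv mf (fun x _ => fM x).
have [iuT _] := avg_pairing ab hc hk iu mT TN.
have mT' : measurable_fun `]a, b[ (fun x =>
    sg * T f x) by exact: measurable_funM.
have TN' x : x \in `]a, b[ -> `|sg * T f x| <= `|sg| * N.
  by move=> xab; rewrite normrM ler_wpM2l// TN.
rewrite -RintegralZl//.
have -> : \int[mu]_(x in `]a, b[) (sg * (avg c k u x * T f x)) =
    \int[mu]_(x in `]a, b[) (avg c k u x * (sg * T f x)).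
  by apply: eq_Rintegral => x _; rewrite mulrCA.
have [_ ->] := avg_pairing ab hc hk iu mT' TN'.
congr fine; apply: eq_integral => l _; congr EFin.
have [ll|ll] := boolP (l \in `[l0, l1]); last by rewrite k0// !mul0r.
have l_gt0 : 0 < l by move: ll; rewrite in_itv/= => /andP[/(lt_le_trans l00)].
have l_lt1 : l < 1 by move: ll; rewrite in_itv/= => /andP[_ /le_lt_trans];
    apply.
rewrite -mulrA; congr (_ * _).
(* With order 0 the operator is the identity, and this is the plain change of variables. *)
have := pairing_dil (derive1n_covariant 0 acb) ccf l_gt0 l_lt1 iv.
rewrite /= powRr0 mul1r => ->.
have ccl := dil_fun_cc_smooth acb l_gt0 (ltW l_lt1) ccf.
rewrite uv//.
have -> : \int[mu]_(x in `]a, b[) (u (dil c l x) * (sg * T f x)) =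
    sg * \int[mu]_(x in `]a, b[) (u (dil c l x) * T f x).
  rewrite -RintegralZl//; first by apply: eq_Rintegral => x _; rewrite mulrCA.
  apply: (integrableM_bounded mO _ mT TN).
  have h := integrable_affine (c - l * c) (lt0r_neq0 l_gt0) mO iu.
  rewrite (_ : (fun x => u (dil c l x)) = (fun x => u (l * x + (c - l * c))));
      last first.
    by apply/funext => x; rewrite dilE.
  apply: integrableS h; [|exact: mO|].
    exact: (@measurable_preimage_affine _ l (c - l * c) `]a, b[%classic
        (measurable_itv _)).
  by move=> x /= xab; rewrite -dilE; exact: (dil_in acb l_gt0 (ltW l_lt1)).
rewrite (pairing_dil covT ccf l_gt0 l_lt1 iu); ring.
Qed.

End average_of_weak_derivative.

(** * Smoothness of averages *)

Section smoothness_of_averages.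
Context {R : realType}.
Local Notation mu := (@lebesgue_measure R).
Variables (a b c : R).
Hypotheses (ab : a < b) (hc : c = a \/ c = b).
Implicit Types (u k : R -> R).

Let mO : measurable (`]a, b[%classic : set (measurableTypeR R)).
Proof. exact: measurable_itv. Qed.

Lemma diff_order_inv_shift n : diff_order `]a, b[%classic n (fun x : R =>
    (x - c)^-1).
Proof.
elim: n => // n IH; exists (fun x => -1 * ((x - c)^-1 * (x - c)^-1)).
  move=> x /= xab; have xc := center_neq hc xab.
  have d1 : is_derive x 1 (fun x => x - c) 1.
    by have := is_deriveB (is_derive_id x 1) (is_derive_cst c x 1);
        rewrite subr0.
  have <- : - (x - c) ^- 2 = -1 * ((x - c)^-1 * (x - c)^-1).
    by rewrite mulN1r -invfM expr2.
  by have := is_deriveV (f := fun y => y - c) xc d1; rewrite scaler1.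
by apply: diff_orderM; [exact: diff_order_cst | exact: diff_orderM].
Qed.

(** The average after the substitution z = tau_l x, so l = (z - c) / (x - c), but without the
    Jacobian 1 / |x - c|. *)
Definition dil_conv k u x := \int[mu]_(z in `]a, b[) (u z * k ((z - c) / (x -
    c))).

(** The Euler operator l d/dl preserves the class of kernels, which allows [dil_conv] to be
    differentiated repeatedly. *)
Lemma cc_smooth_euler k : cc_smooth `]0, 1[ k ->
  cc_smooth `]0, 1[ (fun l => l * derive1n 1 k l).
Proof.
move=> cck; have [sk' [K [cK KO K0]]] := cc_smooth_derive1n 1 cck; split.
  apply: smooth_onM; [exact: openT| |exact: sk'].
  by apply: smooth_on_id; exact: openT.
by exists K; split=> // x Kx; rewrite K0// mulr0.
Qed.

(* d/dx k (z / x) = - x^-1 (l k' l) at l = z / x: the derivative of a convolution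
   is again one, up to the smooth factor x^-1. *)
Lemma is_derive_dil_conv k u x : cc_smooth `]0, 1[ k ->
  mu.-integrable `]a, b[ (EFin \o u) -> x \in `]a, b[ ->
  is_derive x 1 (dil_conv k u)
    (-1 * ((x - c)^-1 * dil_conv (fun l => l * derive1n 1 k l) u x)).
Proof.
move=> cck iu xab; have cce := cc_smooth_euler cck.
set k1 := (fun l => l * derive1n 1 k l) in cce *.
have [M kM] := cc_smooth_bounded cck; have [N kN] := cc_smooth_bounded cce.
have N0 : 0 <= N by apply: le_trans (kN 0).
pose K (y z : R) := u z * k ((z - c) / (y - c)).
(* On ]p, q[ the distance to c stays at least |x - c| / 2, whichever endpoint c is. The factor 1 /
   (y - c) is then bounded, as the domination by [G] requires. *)
pose p := (a + x) / 2; pose q := (x + b) / 2.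
have [ax xb] : a < x /\ x < b by move: xab; rewrite in_itv/= => /andP.
have sub y : `]p, q[%classic y -> y \in `]a, b[.
  by rewrite /p /q /= !in_itv/= => /andP[? ?]; apply/andP; split; lra.
have far y : `]p, q[%classic y -> `|x - c| / 2 <= `|y - c|.
  rewrite /p /q /= !in_itv/= => /andP[h1 h2].
  case: hc => ->; [rewrite !gtr0_norm|rewrite !ltr0_norm]; lra.
have xc0 : 0 < `|x - c| / 2 by rewrite divr_gt0// normr_gt0 (center_neq hc).
have mk (f : R -> R) (y : R) : cc_smooth `]0, 1[ f ->
    measurable_fun `]a, b[ (fun z => f ((z - c) / (y - c))).
  move=> ccf; apply: measurable_funTS; apply: continuous_measurable_fun => z.
  apply: continuous_comp; last by apply: (smooth_on_continuous ccf.1).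
  apply: cvgM; last exact: cvg_cst.
  by apply: cvgB; [exact: cvg_id|exact: cvg_cst].
have iK y : `]p, q[%classic y -> mu.-integrable `]a, b[ (EFin \o K y).
  by move=> _; exact: (integrableM_bounded mO iu (mk _ y cck) (fun z _ =>
      kM _)).
have dK (y z : R) : `]p, q[%classic y ->
    is_derive y 1 (K ^~ z) (-1 * (y - c)^-1 * (u z * k1 ((z - c) / (y - c)))).
  move=> /sub yab; have yc := center_neq hc yab.
  have d1 : is_derive y 1 (fun y => y - c) 1.
    by have := is_deriveB (is_derive_id y 1) (is_derive_cst c y 1);
        rewrite subr0.
  have d2 := is_deriveZ_eq (k := z - c) (is_deriveV (f := fun y =>
      y - c) yc d1) erefl.
  have d3 : is_derive ((z - c) / (y - c)) 1 k (derive1n 1 k ((z - c) / (y -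
      c))).
    by have [sk _] := cck; exact: (smooth_on_is_derive sk).
  have d4 := is_derive_comp_eq (g := fun y => (z - c) / (y - c)) d3 d2 erefl.
  apply: (is_deriveZ_eq d4); rewrite /k1 scaler1 expr2 invfM; ring.
have p1E (y z : R) : `]p, q[%classic y ->
    partial1of2 K y z = -1 * (y - c)^-1 * (u z * k1 ((z - c) / (y - c))).
  by move=> yI; rewrite partial1of2E; have [_ ->] := dK y z yI.
have xI : `]p, q[%classic x.
  by rewrite /p /q /= in_itv/=; apply/andP; split; lra.
pose G z := (`|x - c| / 2)^-1 * N * `|u z|.
have iG : mu.-integrable `]a, b[ (EFin \o G).
  have := integrableZl mO ((`|x - c| / 2)^-1 * N) (integrable_norm iu).
  by apply: eq_integrable.
have G0 z : 0 <= G z by rewrite !mulr_ge0// invr_ge0 ltW.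
have KG (y z : R) : `]p, q[%classic y -> `]a, b[%classic z ->
    `|partial1of2 K y z| <= G z.
  move=> yI _; rewrite p1E// !normrM normrN1 mul1r normfV [`|u z| * _]mulrC
      mulrA.
  rewrite ler_wpM2r//; apply: ler_pM; [by rewrite invr_ge0|by []| |by have :=
      kN ((z - c) / (y - c)); rewrite /k1 !normrM normfV].
  by rewrite lef_pV2 ?posrE ?far// normr_gt0 (center_neq hc)// sub.
have dKK (y z : R) : `]p, q[%classic y -> `]a, b[%classic z ->
    derivable (K ^~ z) y 1.
  by move=> yI _; have [] := dK y z yI.
have d := derivable_under_integral mO xI iK dKK G0 iG KG.
have dE := differentiation_under_integral mO xI iK dKK G0 iG KG.
apply: DeriveDef; first exact: d.
rewrite -derive1E dE.
rewrite mulrA /dil_conv -RintegralZl//; last first.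
  exact: (integrableM_bounded mO iu (mk _ x cce) (fun z _ => kN _)).
by apply: eq_Rintegral => z _; exact: p1E.
Qed.

Lemma smooth_dil_conv k u : cc_smooth `]0, 1[ k ->
  mu.-integrable `]a, b[ (EFin \o u) -> smooth_on `]a, b[ (dil_conv k u).
Proof.
move=> + iu; move=> cck; apply/smooth_onP; first exact: itv_open.
move=> n; elim: n k cck => // n IH k cck.
exists (fun x => -1 * ((x - c)^-1 * dil_conv (fun l =>
    l * derive1n 1 k l) u x)).
  by move=> x xab; exact: is_derive_dil_conv.
apply: diff_orderM; first exact: diff_order_cst.
apply: diff_orderM; first exact: diff_order_inv_shift.
by apply: IH; exact: cc_smooth_euler.
Qed.

Lemma smooth_avg k u : cc_smooth `]0, 1[ k ->
  mu.-integrable `]a, b[ (EFin \o u) -> smooth_on `]a, b[ (avg c k u).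
Proof.
move=> cck iu; have oO : open (`]a, b[%classic : set R) by exact: itv_open.
have s1 : smooth_on `]a, b[ (fun x : R => (x - c)^-1).
  by apply/smooth_onP => // n; exact: diff_order_inv_shift.
(* The constant sign of x - c on the interval, so that the Jacobian 1 / |x - c| is the smooth
   function e / (x - c). *)
pose e : R := if c == a then 1 else -1.
have := smooth_onM oO (smooth_on_cst (c := e) oO) (smooth_onM oO s1
    (smooth_dil_conv cck iu)).
apply: smooth_on_eq => // x /= xab; have xc := center_neq hc xab.
have mk : measurable_fun `]a, b[ (fun z => k ((z - c) / (x - c))).
  apply: measurable_funTS; apply: continuous_measurable_fun => z.
  apply: continuous_comp; last by apply: (smooth_on_continuous cck.1).
  apply: cvgM; last exact: cvg_cst.
  by apply: cvgB; [exact: cvg_id|exact: cvg_cst].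
have mu_ : measurable_fun `]a, b[ u by case/integrableP : iu =>
    /measurable_EFinP.
have E := Rintegral_affine c xc mO (measurable_funM mu_ mk).
rewrite {1}/dil_conv E.
have -> : e * ((x - c)^-1 * (`|x - c| *
    \int[mu]_(l in [set l | `]a, b[%classic ((x - c) * l + c)]) (u ((x - c) * l
        + c) * k (((x - c) * l + c - c) / (x - c)))))
  = \int[mu]_(l in [set l | `]a, b[%classic ((x - c) * l + c)]) (u ((x - c) * l
      + c) * k (((x - c) * l + c - c) / (x - c))).
  rewrite !mulrA -[RHS]mul1r; congr (_ * _).
  move: xab; rewrite in_itv/= => /andP[ax xb]; rewrite /e.
  case: eqP => [ca|ca].
    by rewrite gtr0_norm ?mul1r ?mulVf// ca subr_gt0.
  have cb : c = b by case: hc.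
  by rewrite ltr0_norm ?mulN1r ?mulNr ?mulrN ?opprK ?mulVf// cb subr_lt0.
rewrite /avg Rintegral_mkcond [RHS]Rintegral_mkcond; apply: eq_Rintegral => l _.
have [_ [K [_ KO K0]]] := cck.
rewrite !patchE addrK mulrAC mulfV// mul1r /dil [c + _]addrC [l * _]mulrC [k l
    * _]mulrC.
case: (boolP (l \in `]0, 1[)) => lJ; last first.
  rewrite K0 ?mulr0 ?if_same// => /KO.
  by apply/negP.
rewrite !mem_set//=.
move: lJ; rewrite in_itv/= => /andP[lp lq].
have -> : (x - c) * l + c = dil c l x by rewrite /dil; ring.
by apply: dil_in => //; [case: hc => ->; rewrite lexx ltW|exact: ltW].
Qed.

End smoothness_of_averages.

(** * Approximation in L^p *)

Section power_integrals.
Context {R : realType}.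
Local Notation mu := (@lebesgue_measure R).
Variables (a b p : R).
Hypotheses (ab : a < b) (p1 : 1 <= p).
Implicit Types (f g h w : R -> R).

Let mO : measurable (`]a, b[%classic : set (measurableTypeR R)).
Proof. exact: measurable_itv. Qed.

Let muO : (mu `]a, b[ < +oo)%E.
Proof. by rewrite lebesgue_measure_itv/= lte_fin ab -EFinB ltry. Qed.

Let p0 : 0 < p. Proof. exact: lt_le_trans p1. Qed.

(** Keeping the p-th power of the norm suits Jensen and Tonelli. Minkowski's inequality is replaced
    by [Lp_powD], whose constant 2^p is harmless. *)
Definition Lp_pow w : \bar R := (\int[mu]_(x in `]a, b[) (`|w x| `^ p)%:E)%E.

Lemma Lp_pow_ge0 w : (0 <= Lp_pow w)%E.
Proof. by apply: integral_ge0 => x _; rewrite lee_fin powR_ge0. Qed.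

Lemma measurable_powR_norm (D : set R) w : measurable_fun D w ->
  measurable_fun D (fun x => (`|w x| `^ p)%:E).
Proof.
move=> mw; apply/measurable_EFinP; apply: (measurableT_comp (measurable_powR
    p)).
exact: measurableT_comp.
Qed.

Lemma le_Lp_pow f g : measurable_fun `]a, b[ f -> measurable_fun `]a, b[ g ->
  (forall x, x \in `]a, b[ -> `|f x| <= `|g x|) -> (Lp_pow f <= Lp_pow g)%E.
Proof.
move=> mf mg fg; apply: ge0_le_integral => //.
- exact: measurable_powR_norm.
- exact: measurable_powR_norm.
- by move=> x xab; rewrite lee_fin ge0_ler_powR ?nnegrE ?(ltW p0)//; exact: fg.
Qed.

Lemma powR_normD (x y : R) : `|x + y| `^ p <= 2 `^ p * (`|x| `^ p + `|y| `^ p).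
Proof.
wlog xy : x y / `|x| <= `|y|.
  move=> H; have [/H//|/ltW/H] := leP `|x| `|y|.
  by rewrite addrC [X in _ <= _ * X]addrC.
have h : `|x + y| <= 2 * `|y|.
  by apply: (le_trans (ler_normD x y)); rewrite mulr_natl mulr2n lerD2r.
apply: (@le_trans _ _ ((2 * `|y|) `^ p)).
  by rewrite ge0_ler_powR ?nnegrE ?(ltW p0)// mulr_ge0.
by rewrite powRM// ler_wpM2l ?powR_ge0// lerDr powR_ge0.
Qed.

Lemma Lp_powD f g : measurable_fun `]a, b[ f -> measurable_fun `]a, b[ g ->
  (Lp_pow (fun x => f x + g x)%R <= (2 `^ p)%:E * (Lp_pow f + Lp_pow g))%E.
Proof.
move=> mf mg; have m1 := measurable_powR_norm mf;
    have m2 := measurable_powR_norm mg.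
have g0 w : forall x, (`]a, b[%classic x -> 0 <= (`|w x| `^ p)%:E)%E.
  by move=> x _; rewrite lee_fin powR_ge0.
rewrite /Lp_pow -(ge0_integralD _ mO (g0 f) m1 (g0 g) m2).
rewrite -ge0_integralZl; [|exact: mO|exact: emeasurable_funD| |]; last 2 first.
- by move=> x xO; rewrite adde_ge0// lee_fin powR_ge0.
- by rewrite lee_fin powR_ge0.
apply: ge0_le_integral; [exact: mO| | | |].
- exact: g0.
- by apply: measurable_powR_norm; exact: measurable_funD.
- by apply: measurable_funeM; exact: emeasurable_funD.
- by move=> x _; rewrite -EFinD -EFinM lee_fin powR_normD.
Qed.

(** Since |f|^p = |f|^(p-1) |f|, smallness in L^1 becomes smallness in L^p for functions with a
    common bound. *)
Lemma Lp_pow_bounded f (B : R) : measurable_fun `]a, b[ f ->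
  (forall x, x \in `]a, b[ -> `|f x| <= B) ->
  (Lp_pow f <= (B `^ (p - 1))%:E * \int[mu]_(x in `]a, b[) `|f x|%:E)%E.
Proof.
move=> mf fB; have mf' : measurable_fun `]a, b[ (fun x => `|f x|%:E).
  by apply/measurable_EFinP; exact: measurableT_comp.
rewrite -ge0_integralZl//; last by rewrite lee_fin powR_ge0.
apply: ge0_le_integral => //.
- exact: measurable_powR_norm.
- exact: measurable_funeM.
- move=> x xab; rewrite -EFinM lee_fin -mulr_powRB1// mulrC ler_wpM2r//.
  by rewrite ge0_ler_powR ?nnegrE ?subr_ge0//;
      [exact: le_trans (fB _ xab)|exact: fB].
Qed.

Lemma Lp_pow_dil c l w : c = a \/ c = b -> 0 < l -> l < 1 ->
    measurable_fun `]a, b[ w ->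
  (Lp_pow (fun x => w (dil c l x)) <= l^-1%:E * Lp_pow w)%E.
Proof.
move=> hc l0 l1 mw; have ln0 : l != 0 by rewrite gt_eqF.
have acb : a <= c <= b by case: hc => ->; rewrite lexx ltW.
have mw' := measurable_powR_norm mw.
have := ge0_integral_affine (c - l * c) ln0 mO mw'.
move=> /(_ (fun x _ => powR_ge0 _ _)); rewrite -/(Lp_pow w) => ->.
rewrite gtr0_norm// muleA -EFinM mulVf// mul1e /Lp_pow.
under eq_integral do rewrite dilE.
have mD := @measurable_preimage_affine _ l (c - l * c) `]a, b[%classic mO.
apply: ge0_subset_integral => //.
- apply/measurable_EFinP; apply: (measurableT_comp (measurable_powR p)).
  apply: measurableT_comp => //.
  apply: (@measurable_comp _ _ _ _ _ _ `]a, b[%classic w _ (fun x =>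
      l * x + (c - l * c))) => //.
  + by move=> _ /= [x Dx <-].
  + by apply: measurable_funTS; exact: measurable_affine.
- move=> x /= xab; rewrite -dilE; exact: (dil_in acb l0 (ltW l1)).
Qed.

Lemma dil_measurable c l w : c = a \/ c = b -> 0 < l -> l < 1 ->
    measurable_fun `]a, b[ w ->
  measurable_fun `]a, b[ (fun x => w (dil c l x)).
Proof.
move=> hc l0 l1 mw.
have acb : a <= c <= b by case: hc => ->; rewrite lexx ltW.
apply: (@measurable_comp _ _ _ _ _ _ `]a, b[%classic w _ (dil c l)) => //.
- by move=> _ /= [x Dx <-]; exact: (dil_in acb l0 (ltW l1)).
- rewrite (_ : dil c l = (fun x => l * x + (c - l * c))).
    by apply: measurable_funTS; exact: measurable_affine.
  by apply/funext => x; rewrite dilE.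
Qed.

Definition clip (M y : R) := Num.max (- M) (Num.min y M).

Lemma clip_norm M y : 0 <= M -> `|clip M y| <= M.
Proof. by move=> M0; rewrite /clip ler_norml le_max lexx/= ge_max ge_min lexx
    orbT andbT; lra. Qed.

Lemma clip_id M y : `|y| <= M -> clip M y = y.
Proof.
rewrite ler_norml => /andP[h1 h2]; rewrite /clip min_l// max_r//.
Qed.

Lemma clip_lipschitz M y z : `|clip M y - clip M z| <= `|y - z|.
Proof.
have n1 (x : R) : x <= `|x| := ler_norm x.
have n2 (x : R) : - x <= `|x| by rewrite -normrN ler_norm.
have h1 (r s t : R) : `|Num.max r s - Num.max r t| <= `|s - t|.
  have := n1 (s - t); have := n2 (s - t); have := normr_ge0 (s - t).
  by case: (leP r s) => ?; case: (leP r t) => ? ? ? ?;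
      rewrite ?subrr ?normr0// ler_norml; apply/andP; split; lra.
have h2 (r s t : R) : `|Num.min s r - Num.min t r| <= `|s - t|.
  have := n1 (s - t); have := n2 (s - t); have := normr_ge0 (s - t).
  by case: (leP s r) => ?; case: (leP t r) => ? ? ? ?;
      rewrite ?subrr ?normr0// ler_norml; apply/andP; split; lra.
by rewrite /clip; apply: (le_trans (h1 _ _ _)); exact: h2.
Qed.

Lemma clip_continuous M : continuous (clip M).
Proof.
move=> x; apply: (@continuous_max _ R (cst (- M)) (fun y => Num.min y M));
    first exact: cst_continuous.
apply: (@continuous_min _ R id (cst M)); [exact: cvg_id|exact: cst_continuous].
Qed.

Lemma clip0 M : 0 <= M -> clip M 0 = 0.
Proof. by move=> M0; rewrite clip_id// normr0. Qed.

Lemma Lp_pow_integrable w : measurable_fun `]a, b[ w -> (Lp_pow w < +oo)%E ->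
  mu.-integrable `]a, b[ (EFin \o (fun x => `|w x| `^ p)).
Proof.
move=> mw fin; apply/integrableP; split; first exact: measurable_powR_norm.
apply: le_lt_trans fin; rewrite /Lp_pow le_eqVlt; apply/orP; left; apply/eqP.
by apply: eq_integral => x _; rewrite /= ger0_norm// powR_ge0.
Qed.

Lemma Lp_pow_clip_approx w e : measurable_fun `]a, b[ w ->
    (Lp_pow w < +oo)%E -> 0 < e ->
  exists M : R, 0 <= M /\ (Lp_pow (fun x => w x - clip M (w x))%R < e%:E)%E.
Proof.
move=> mw fin e0.
have mclip n : measurable_fun `]a, b[ (fun x => clip n.+1%:R (w x)).
  apply: measurableT_comp => //; apply: continuous_measurable_fun;
      exact: clip_continuous.
pose I n := (\int[mu]_(x in `]a, b[) (`|w x - clip n.+1%:R (w x)| `^ p)%:E)%E.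
have Icvg : (I n @[n --> \oo] --> \int[mu]_(x in `]a, b[) (cst 0 x : \bar R))%E.
  (* The dominating function comes from [powR_normD] together with |clip w| <= |w|. Pointwise the
     difference is eventually exactly zero. *)
  apply: (@dominated_cvg _ _ _ mu _ mO _ _ (fun x =>
      (2 `^ p * 2 * (`|w x| `^ p))%:E)).
  - by move=> n; apply: measurable_powR_norm; apply: measurable_funB.
  - move=> x _; apply: cvg_near_cst; near=> n.
    rewrite clip_id ?subrr ?normr0 ?powR0 ?gt_eqF//.
    near: n; exists (Num.truncn `|w x|).+1 => // m /= hm.
    apply: ltW; apply: (lt_le_trans (truncnS_gt _)); rewrite ler_nat.
    exact: leq_trans hm _.
  - by [].
  - have := integrableZl mO (2 `^ p * 2) (Lp_pow_integrable mw fin).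
    by apply: eq_integrable => // x _ /=; rewrite -EFinM.
  - move=> n x _; rewrite /= lee_fin ger0_norm ?powR_ge0//.
    apply: (le_trans (powR_normD _ _)); rewrite -mulrA ler_wpM2l ?powR_ge0//.
    rewrite normrN mulr_natl mulr2n lerD2l ge0_ler_powR ?nnegrE ?(ltW p0)//.
    by have := clip_lipschitz n.+1%:R (w x) 0; rewrite clip0// !subr0.
suff [n In] : exists n, (I n < e%:E)%E by exists n.+1%:R; split.
apply: contrapT => /forallNP H.
have : (e%:E <= limn I)%E.
  apply: lime_ge; first by apply/cvg_ex; eexists; exact: Icvg.
  by apply: nearW => n; rewrite leNgt; apply/negP; exact: H.
by rewrite (cvg_lim _ Icvg)// integral0 lee_fin leNgt e0.
Unshelve. all: by end_near. Qed.

(** The function w is truncated, the truncation is approximated in L^1 by a continuous function, and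
    that function is truncated too. With a common bound M, the L^1 error controls the L^p error. *)
Lemma Lp_pow_continuous_approx w e : measurable_fun `]a, b[ w ->
    (Lp_pow w < +oo)%E -> 0 < e ->
  exists g, exists M : R, [/\ continuous g, 0 <= M, forall x, `|g x| <= M &
    (Lp_pow (fun x => w x - g x)%R <= e%:E)%E].
Proof.
move=> mw fin e0; have c0 : 0 < 2 `^ p * 2 :> R by rewrite mulr_gt0// powR_gt0.
pose e1 := e / (2 `^ p * 2); have e10 : 0 < e1 by rewrite divr_gt0.
have [M [M0 hM]] := Lp_pow_clip_approx mw fin e10.
have mclip : measurable_fun `]a, b[ (fun x => clip M (w x)).
  apply: measurableT_comp => //; apply: continuous_measurable_fun;
      exact: clip_continuous.
have iclip : mu.-integrable `]a, b[ (EFin \o (fun x => clip M (w x))).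
  apply: measurable_bounded_integrable => //.
  exists M; split; first exact: num_real.
  by move=> y /ltW My x _ /=; apply: le_trans My; exact: clip_norm.
have [h [ch ih hcvg]] := approximation_continuous_integrable mO muO iclip.
(* The constant of [Lp_pow_bounded] for a difference of two functions bounded by M. The added 1
   keeps it positive when M = 0. *)
pose C := (M + M) `^ (p - 1) + 1; have C0 : 0 < C by rewrite ltr_wpDl//
    powR_ge0.
have e20 : 0 < e1 / C by rewrite divr_gt0.
have [n hn] : exists n, (\int[mu]_(x in `]a, b[) `|(clip M (w x) - h n x)%:E| <
    (e1 / C)%:E)%E.
  apply: contrapT => /forallNP H.
  have : ((e1 / C)%:E <= limn (fun n => \int[mu]_(x in `]a, b[) `|(clip M (w x)
      - h n x)%:E|))%E.
    apply: lime_ge; first by apply/cvg_ex; eexists; exact: hcvg.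
    by apply: nearW => n; rewrite leNgt; apply/negP; exact: H.
  by rewrite (cvg_lim _ hcvg)// lee_fin leNgt e20.
have cg : continuous (fun x => clip M (h n x)).
  by move=> x; apply: continuous_comp; [exact: ch|exact: clip_continuous].
have mg : measurable_fun `]a, b[ (fun x => clip M (h n x)).
  by apply: measurable_funTS; exact: continuous_measurable_fun.
exists (fun x => clip M (h n x)), M; split=> //; first by move=> x;
    exact: clip_norm.
have -> : (fun x => w x - clip M (h n x)) =
    (fun x => (w x - clip M (w x)) + (clip M (w x) - clip M (h n x))).
  by apply/funext => x; rewrite addrA subrK.
have md : measurable_fun `]a, b[ (fun x =>
    clip M (w x) - clip M (h n x)) by exact: measurable_funB.
have md2 : measurable_fun `]a, b[ (fun x =>
    w x - clip M (w x)) by exact: measurable_funB.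
apply: (le_trans (Lp_powD md2 md)).
have h2 : (Lp_pow (fun x => clip M (w x) - clip M (h n x))%R <= e1%:E)%E.
  have mh : measurable_fun `]a, b[ (h n) by apply: measurable_funTS;
      exact: continuous_measurable_fun.
  apply: (le_trans (Lp_pow_bounded (B := M + M) md _)).
    by move=> x _; apply: (le_trans (ler_normB _ _)); rewrite lerD// clip_norm.
  apply: (@le_trans _ _ (C%:E * (e1 / C)%:E)%E); last first.
    by rewrite -EFinM lee_fin mulrC divfK// gt_eqF.
  apply: lee_pmul.
  - by rewrite lee_fin powR_ge0.
  - by apply: integral_ge0.
  - by rewrite lee_fin /C lerDl.
  - apply: le_trans (ltW hn); apply: ge0_le_integral => //.
    + by apply/measurable_EFinP; exact: measurableT_comp.
    + by apply/measurable_EFinP; apply: measurableT_comp => //;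
        exact: measurable_funB.
    + move=> x _; rewrite lee_fin.
      by have := clip_lipschitz M (clip M (w x)) (h n x);
          rewrite (clip_id (clip_norm _ M0)).
apply: (@le_trans _ _ ((2 `^ p)%:E * (e1%:E + e1%:E))%E).
  apply: lee_wpmul2l; first by rewrite lee_fin powR_ge0.
  exact: leeD (ltW hM) h2.
rewrite -EFinD -EFinM lee_fin /e1.
have -> : 2 `^ p * (e / (2 `^ p * 2) + e / (2 `^ p * 2)) = e by field;
    rewrite gt_eqF// powR_gt0.
exact: lexx.
Qed.

(** The L^1 distance is continuous in l by dominated convergence and vanishes at l = 1. Boundedness
    of g then converts it to the p-th power. *)
Lemma Lp_pow_dil_continuous c gam g (M e : R) : c = a \/ c = b -> 0 <= gam ->
  continuous g -> 0 <= M -> (forall x, `|g x| <= M) -> 0 < e ->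
  exists eta : R, [/\ 0 < eta, eta < 1 & forall l, eta < l -> l < 1 ->
    (Lp_pow (fun x => g x - l `^ gam * g (dil c l x))%R <= e%:E)%E].
Proof.
move=> hc gam0 cg M0 gM e0.
(* Continuity at l = 1 calls for a two-sided neighbourhood. On ]1/2, 3/2[ the weight l^gam is at
   most [B]. *)
pose B : R := (3 / 2) `^ gam.
pose N := M + B * M; have N0 : 0 <= N by rewrite addr_ge0// mulr_ge0// powR_ge0.
pose f (l x : R) := `|g x - l `^ gam * g (dil c l x)|.
have fN l x : `](1/2), (3/2)[%classic l -> `|f l x| <= N.
  rewrite /= in_itv/= => /andP[l1 l2]; rewrite /f normr_id.
  apply: (le_trans (ler_normB _ _)); rewrite lerD// normrM ler_pM//.
  by rewrite ger0_norm ?powR_ge0// ge0_ler_powR ?nnegrE//; lra.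
have mf l (D : set R) : measurable_fun D (f l).
  apply: measurable_funTS; apply: continuous_measurable_fun => x.
  apply: cvg_norm; apply: cvgB; first exact: cg.
  apply: cvgM; first exact: cvg_cst.
  apply: (@continuous_comp _ _ _ (dil c l) g); last exact: cg.
  apply: cvgD; first exact: cvg_cst.
  by apply: cvgM; [exact: cvg_cst|apply: cvgB; [exact: cvg_id|exact: cvg_cst]].
have iN : mu.-integrable `]a, b[ (EFin \o cst N).
  apply: measurable_bounded_integrable => //.
  exists N; split; first exact: num_real.
  by move=> y /ltW Ny x _ /=; rewrite ger0_norm.
have fi l : `](1/2), (3/2)[%classic l -> mu.-integrable `]a, b[ (EFin \o f l).
  move=> lI; apply: le_integrable iN => //; first by apply/measurable_EFinP;
      exact: mf.
  by move=> x _; rewrite lee_fin /= (ger0_norm N0) fN.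
have fcont x : {in `](1/2), (3/2)[%classic, continuous (f ^~ x)}.
  move=> l /set_mem /=; rewrite in_itv/= => /andP[l1 l2];
      have l0 : 0 < l by lra.
  apply: cvg_norm; apply: cvgB; first exact: cvg_cst.
  apply: cvgM.
    have [/derivable1_diffP/differentiable_continuous h _] := is_derive1_powR
        gam l0.
    exact: h.
  apply: (@continuous_comp _ _ _ (fun l => dil c l x) g); last exact: cg.
  apply: cvgD; first exact: cvg_cst.
  by apply: cvgM; [exact: cvg_id|exact: cvg_cst].
have one : (1 : R) \in `](1/2), (3/2)[%classic by rewrite inE /= in_itv/=;
    apply/andP; split; lra.
have cf : {ae mu, forall x, `]a, b[%classic x -> {in `](1/2), (3/2)[%classic,
    continuous (f ^~ x)}}.
  by apply: aeW => x _; exact: fcont.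
have gub l : `](1/2), (3/2)[%classic l -> {ae mu, forall x,
    `]a, b[%classic x -> `|f l x| <= cst N x}.
  by move=> lI; apply: aeW => x _; exact: fN.
have := continuity_under_integral mO fi cf iN gub one.
have F1 : \int[mu]_(x in `]a, b[) f 1 x = 0.
  rewrite /Rintegral integral0_eq// => x _.
  by rewrite /f powR1 mul1r /dil mul1r addrCA subrr addr0 subrr normr0.
rewrite /continuous_at F1 => /cvgr0_norm_lt.
pose C := N `^ (p - 1) + 1; have C0 : 0 < C by rewrite ltr_wpDl// powR_ge0.
have d0 : 0 < e / C by rewrite divr_gt0.
move=> /(_ _ d0) /nbhs_ballP [r /= r0 hr].
have hmax : Num.max (1/2) (1 - r) < 1 :> R by rewrite gt_max; apply/andP;
    split; lra.
exists (Num.max (1/2) (1 - r)); split=> //.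
  by rewrite lt_max; apply/orP; left; lra.
move=> l; rewrite gt_max => /andP[l1 l2] l3.
have lI : `](1/2), (3/2)[%classic l by rewrite /= in_itv/=; apply/andP; split;
    lra.
have /hr Fl : ball (1 : R) r l by rewrite /ball/= ger0_norm; lra.
have mfl : measurable_fun `]a, b[ (fun x => g x - l `^ gam * g (dil c l x)).
  have mg : measurable_fun `]a, b[ g by apply: measurable_funTS;
      exact: continuous_measurable_fun.
  apply: measurable_funB => //; apply: measurable_funM => //.
  by apply: dil_measurable => //; lra.
apply: (le_trans (Lp_pow_bounded (B := N) mfl _)).
  by move=> x _; have := fN l x lI; rewrite /f normr_id.
have -> : (\int[mu]_(x in `]a, b[) `|g x - l `^ gam * g (dil c l x)|%:E =
    (\int[mu]_(x in `]a, b[) f l x)%:E)%E.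
  by rewrite /Rintegral fineK//; exact: (integrable_fin_num mO (fi _ lI)).
rewrite -EFinM lee_fin.
apply: (@le_trans _ _ (C * (e / C))); last by rewrite mulrC divfK// gt_eqF.
apply: ler_pM.
- by rewrite powR_ge0.
- by apply: Rintegral_ge0 => x _; exact: normr_ge0.
- by rewrite /C lerDl.
- exact: le_trans (ler_norm _) (ltW Fl).
Qed.

Lemma Lp_pow_dil_approx c gam w (e : R) : c = a \/ c = b -> 0 <= gam ->
  measurable_fun `]a, b[ w -> (Lp_pow w < +oo)%E -> 0 < e ->
  exists eta : R, [/\ 0 < eta, eta < 1 & forall l, eta < l -> l < 1 ->
    (Lp_pow (fun x => w x - l `^ gam * w (dil c l x))%R <= e%:E)%E].
Proof.
move=> hc gam0 mw fin e0.
(* Splitting into w - g, the same difference for g, and the dilated g - w uses [Lp_powD] twice. The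
   inner 2 bounds the Jacobian 1/l for l > 1/2. *)
pose D : R := 2 `^ p * (1 + 2 `^ p * (1 + 2)).
have c0 : 0 < 2 `^ p :> R by rewrite powR_gt0.
have D0 : 0 < D by rewrite /D; nra.
have d0 : 0 < e / D by rewrite divr_gt0.
have [g [M [cg M0 gM hg]]] := Lp_pow_continuous_approx mw fin d0.
have [eta [eta0 eta1 heta]] := Lp_pow_dil_continuous hc gam0 cg M0 gM d0.
have mg : measurable_fun `]a, b[ g by apply: measurable_funTS;
    exact: continuous_measurable_fun.
exists (Num.max (1/2) eta); split.
- by rewrite lt_max eta0 orbT.
- by rewrite gt_max eta1 andbT; lra.
move=> l; rewrite gt_max => /andP[l1 l2] l3; have l0 : 0 < l by lra.
have -> : (fun x => w x - l `^ gam * w (dil c l x)) =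
  (fun x => (w x - g x) + ((g x - l `^ gam * g (dil c l x)) +
    (- (l `^ gam) * (w (dil c l x) - g (dil c l x))))).
  by apply/funext => x; ring.
have m1 : measurable_fun `]a, b[ (fun x => w x - g x) by exact: measurable_funB.
have m2 : measurable_fun `]a, b[ (fun x => g x - l `^ gam * g (dil c l x)).
  by apply: measurable_funB => //; apply: measurable_funM => //;
      exact: dil_measurable.
have m3 : measurable_fun `]a, b[ (fun x => w (dil c l x) - g (dil c l x)).
  by apply: measurable_funB; exact: dil_measurable.
have m4 : measurable_fun `]a, b[ (fun x =>
    - (l `^ gam) * (w (dil c l x) - g (dil c l x))).
  exact: measurable_funM.
have m5 : measurable_fun `]a, b[ (fun x => (g x - l `^ gam * g (dil c l x)) +
    (- (l `^ gam) * (w (dil c l x) - g (dil c l x)))) by exact: measurable_funD.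
apply: (le_trans (Lp_powD m1 m5)).
have h3 : (Lp_pow (fun x => - (l `^ gam) * (w (dil c l x) - g (dil c l x)))%R
    <= (2 * (e / D))%:E)%E.
  apply: (@le_trans _ _ (Lp_pow (fun x => w (dil c l x) - g (dil c l x))%R)).
    apply: (le_Lp_pow m4 m3) => x _; rewrite normrM normrN (ger0_norm (powR_ge0
        _ _)).
    apply: ler_piMl; first exact: normr_ge0.
    have := @ge0_ler_powR R gam gam0 l 1; rewrite !nnegrE powR1; apply => //;
        exact: ltW.
  apply: (le_trans (@Lp_pow_dil c l (fun x => w x - g x) hc l0 l3 m1)).
  rewrite EFinM; apply: lee_pmul => //; first by rewrite lee_fin invr_ge0 ltW.
    exact: Lp_pow_ge0.
  rewrite lee_fin; rewrite -[leRHS]invrK lef_pV2 ?posrE// ?invr_gt0//; lra.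
apply: (@le_trans _ _ ((2 `^ p)%:E * ((e / D)%:E + (2 `^ p)%:E * ((e / D)%:E +
    (2 * (e / D))%:E)))%E).
  apply: lee_wpmul2l; first by rewrite lee_fin ltW.
  apply: (leeD hg); apply: (le_trans (Lp_powD m2 m4)).
  apply: lee_wpmul2l; first by rewrite lee_fin ltW.
  exact: leeD (heta _ l2 l3) h3.
rewrite -!(EFinD, EFinM) lee_fin.
have -> : 2 `^ p * (e / D + 2 `^ p * (e / D + 2 * (e / D))) = D * (e / D) by
    rewrite /D; ring.
by rewrite mulrC divfK// gt_eqF.
Qed.

End power_integrals.

(** * The L^p error of an average *)

Section averages_in_Lp.
Context {R : realType}.
Local Notation mu := (@lebesgue_measure R).
Variables (a b c p : R).
Hypotheses (ab : a < b) (hc : c = a \/ c = b) (p1 : 1 <= p).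
Implicit Types (k w : R -> R).

Let mO : measurable (`]a, b[%classic : set (measurableTypeR R)).
Proof. exact: measurable_itv. Qed.

Let mJ : measurable (`]0, 1[%classic : set (measurableTypeR R)).
Proof. exact: measurable_itv. Qed.

Let muJ : (mu `]0%R, 1%R[ < +oo)%E.
Proof. by rewrite lebesgue_measure_itv/= lte_fin ltr01 -EFinB ltry. Qed.

Let p0 : 0 < p. Proof. exact: lt_le_trans p1. Qed.

Let acb : a <= c <= b.
Proof. by case: hc => ->; rewrite lexx ltW. Qed.

(** As k has mass 1, the error is itself an average, of w - l^gam (w o tau_l) against k. Jensen
    takes the power inside, and Tonelli leaves the bound e times the mass of k. *)
Lemma Lp_pow_avg_le k l0 l1 B gam w (e : R) : 0 <= e -> 0 <= gam ->
    dil_kernel l0 l1 B k ->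
  (forall l, 0 <= k l) -> \int[mu]_(l in `]0, 1[) k l = 1 ->
  mu.-integrable `]a, b[ (EFin \o w) ->
  (forall l, l \in `[l0, l1] ->
     (Lp_pow a b p (fun x => w x - l `^ gam * w (dil c l x))%R <= e%:E)%E) ->
  (Lp_pow a b p (fun x => w x - avg c (fun l =>
      k l * l `^ gam) w x)%R <= e%:E)%E.
Proof.
move=> e0 gam0 hk k_ge0 k1 iw hle; have [l00 l11 mk kB k0] := hk.
have hkg := dil_kernel_powR gam0 hk.
have mw : measurable_fun `]a, b[ w by case/integrableP : iw =>
    /measurable_EFinP.
pose w0 := w \_ `]a, b[.
have mw0 : measurable_fun setT w0 by exact: (measurable_restrictT _ mO).1.
have ik : mu.-integrable `]0, 1[ (EFin \o k).
  apply: measurable_bounded_integrable => //.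
  - exact: measurable_funTS mk.
  exists B; split; first exact: num_real.
  by move=> y /ltW By x _ /=; apply: le_trans By; exact: kB.
pose H (z : measurableTypeR R * measurableTypeR R) : \bar R :=
  (k z.2 * `|w0 z.1 - z.2 `^ gam * w0 (dil c z.2 z.1)| `^ p *
      \1_(`]a, b[%classic) z.1)%:E.
have H0 z : (0 <= H z)%E by rewrite lee_fin !mulr_ge0 ?powR_ge0// indicE.
have mH : measurable_fun setT H.
  apply/measurable_EFinP; apply: measurable_funM; last first.
    by apply: (@measurableT_comp _ _ _ _ _ _ (\1_(`]a, b[%classic : set
        (measurableTypeR R)) : _ -> R)) => //.
  apply: measurable_funM; first exact: (measurableT_comp mk measurable_snd).
  apply: (measurableT_comp (measurable_powR p)); apply: measurableT_comp => //.
  apply: measurable_funB; first exact: (measurableT_comp mw0 measurable_fst).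
  apply: measurable_funM; first exact: (measurableT_comp (measurable_powR gam)
      measurable_snd).
  apply: (measurableT_comp mw0).
  rewrite /dil; apply: measurable_funD => //.
  apply: measurable_funM; first exact: measurable_snd.
  by apply: measurable_funD => //; exact: measurable_fst.
have step1 : (Lp_pow a b p (fun x => w x - avg c (fun l =>
    k l * l `^ gam) w x)%R <=
    \int[mu]_x \int[mu]_l H (x, l))%E.
  rewrite /Lp_pow integral_mkcond; apply: ge0_le_integral => //.
  - by move=> x _; rewrite patchE; case: ifPn => // _; rewrite lee_fin powR_ge0.
  - apply/(measurable_restrictT _ mO); apply: measurable_powR_norm.
    by apply: measurable_funB => //; exact: (avg_measurable ab hc hkg iw).
  - exact: (@measurable_fun_fubini_tonelli_F _ _ _ _ _ mu H mH H0).
  - move=> x _; rewrite patchE; case: ifPn => [/set_mem/= xab|_]; last first.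
      by apply: integral_ge0 => l _; exact: H0.
    have iwl := avg_integrand_integrable ab hc hkg iw xab.
    have ikw : mu.-integrable `]0, 1[ (EFin \o (fun l => k l * w x)).
      by have := integrableZr mJ (w x) ik; apply: eq_integrable.
    have E : w x - avg c (fun l => k l * l `^ gam) w x =
        \int[mu]_(l in `]0, 1[) (k l * (w x - l `^ gam * w (dil c l x))).
      transitivity (\int[mu]_(l in `]0, 1[) (k l * w x) -
          \int[mu]_(l in `]0, 1[) (k l * l `^ gam * w (dil c l x))).
        by rewrite (RintegralZr _ mJ ik) k1 mul1r.
      rewrite -(RintegralB mJ ikw iwl).
      by apply: eq_Rintegral => l _; rewrite mulrBr mulrA.
    have ig : mu.-integrable `]0, 1[ (EFin \o (fun l =>
        k l * (w x - l `^ gam * w (dil c l x)))).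
      have := integrableB mJ ikw iwl; apply: eq_integrable => // l _ /=.
      by rewrite -EFinB mulrBr mulrA.
    have mgx : measurable_fun (`]0, 1[%classic : set R) (fun l : R =>
        w x - l `^ gam * w (dil c l x)).
      apply: measurable_funB => //; apply: measurable_funM.
        by apply: measurable_funTS; exact: measurable_powR.
      by case/integrableP : (dil_orbit_integrable ab hc iw xab) =>
          /measurable_EFinP.
    rewrite E; apply: (le_trans (jensen_powR p1 mJ (fun l _ =>
        k_ge0 l) ik k1 mgx ig)).
    rewrite le_eqVlt; apply/orP; left; apply/eqP.
    rewrite integral_mkcond; apply: eq_integral => l _.
    have xO : x \in `]a, b[%classic by exact: mem_set.
    rewrite patchE /H; case: ifPn => lJ; rewrite /= indicE xO mulr1; last first.
      rewrite k0 ?mul0r//; apply: contra lJ; rewrite in_itv/= => /andP[h1 h2].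
      by apply: mem_set; rewrite /= in_itv/= (lt_le_trans l00)// (le_lt_trans
          h2).
    have lJ' : l \in `]0, 1[ := set_mem lJ.
    move: lJ'; rewrite in_itv/= => /andP[lp /ltW lq].
    have d1 : dil c l x \in `]a, b[%classic by apply/mem_set/(dil_in acb lp lq).
    by rewrite /w0 !patchE xO d1.
apply: (le_trans step1); rewrite (@fubini_tonelli _ _ _ _ _ mu mu H mH H0).
apply: (@le_trans _ _ (\int[mu]_l (e%:E * (k l)%:E))%E).
  apply: ge0_le_integral => //.
  - by move=> l _; apply: integral_ge0.
  - exact: (@measurable_fun_fubini_tonelli_G _ _ _ _ _ mu H mH H0).
  - by apply: measurable_funeM; exact/measurable_EFinP.
  - move=> l _; have [ll|ll] := boolP (l \in `[l0, l1]); last first.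
      rewrite integral0_eq; first by rewrite k0// mule0.
      by move=> x _; rewrite /H /= k0// !mul0r.
    have l_gt0 : 0 < l by move: ll; rewrite in_itv/= =>
        /andP[/(lt_le_trans l00)].
    have l_lt1 : l < 1 by move: ll; rewrite in_itv/= => /andP[_ /le_lt_trans];
        apply.
    apply: (@le_trans _ _ ((k l)%:E * Lp_pow a b p (fun x =>
        w x - l `^ gam * w (dil c l x))%R)%E).
      rewrite /Lp_pow -ge0_integralZl//; last 2 first.
      + apply: measurable_powR_norm; apply: measurable_funB => //;
          apply: measurable_funM => //.
        exact: dil_measurable.
      + by rewrite lee_fin.
      rewrite le_eqVlt; apply/orP; left; apply/eqP.
      rewrite [RHS]integral_mkcond; apply: eq_integral => x _.
      rewrite [RHS]patchE /H /= indicE; case: ifPn => xab; last first.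
        by rewrite mulr0.
      have d1 : dil c l x \in `]a, b[%classic.
        by apply/mem_set/(dil_in acb l_gt0 (ltW l_lt1)); exact: set_mem xab.
      by rewrite mulr1 /w0 !patchE xab d1 -EFinM.
    by rewrite muleC; apply: lee_wpmul2r; [rewrite lee_fin|exact: hle].
have k1E : (\int[mu]_l (k l)%:E = 1)%E.
  have := integrable_fin_num mJ ik; move: k1; rewrite /Rintegral => k1 fink.
  transitivity (\int[mu]_(l in `]0%R, 1%R[) (k l)%:E)%E;
      last by rewrite -(fineK fink) k1.
  rewrite [RHS]integral_mkcond; apply: eq_integral => l _; rewrite patchE.
  case: ifPn => // lJ; rewrite k0//; apply: contra lJ; rewrite in_itv/= =>
      /andP[h1 h2].
  by apply: mem_set; rewrite /= in_itv/= (lt_le_trans l00)// (le_lt_trans h2).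
rewrite ge0_integralZl; [by rewrite k1E mule1|exact:
    measurableT|exact/measurable_EFinP| |by rewrite lee_fin].
by move=> l _; rewrite lee_fin.
Qed.

End averages_in_Lp.

(** * Smooth averaging densities concentrated near 1 *)

Section averaging_kernel.
Context {R : realType}.
Local Notation mu := (@lebesgue_measure R).

Lemma ebump_le (s t : R) : 0 < s -> s <= t -> ebump s <= ebump t.
Proof.
move=> s0 st; have t0 := lt_le_trans s0 st.
rewrite /ebump /ebump_aux s0 t0 !expr0 !mul1r ler_expR lerN2 lef_pV2 ?posrE//.
Qed.

Lemma exists_averaging_kernel (eta : R) : 0 < eta -> eta < 1 ->
  exists k, exists l0, exists l1, exists B : R,
    [/\ dil_kernel l0 l1 B k, cc_smooth `]0, 1[ k, forall l, 0 <= k l,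
        \int[mu]_(l in `]0, 1[) k l = 1 & eta < l0].
Proof.
(* The support [eta + h, eta + 3h] keeps a margin h from both eta and 1. *)
move=> eta0 eta1; pose h := (1 - eta) / 4;
    have h0 : 0 < h by rewrite divr_gt0// subr_gt0.
have etah : eta + 4 * h = 1 by rewrite /h; field.
pose l0 := eta + h; pose l1 := eta + 3 * h.
have l00 : 0 < l0 by rewrite /l0; lra.
have l11 : l1 < 1 by rewrite /l1; lra.
have l01 : l0 <= l1 by rewrite /l0 /l1; lra.
pose f (l : R) := ebump (1%:R * ((l - l0) * (l1 - l))).
have ccf : cc_smooth `]0, 1[ f by exact: ebump_itv_cc_smooth.
have f0 l : 0 <= f l by exact: ebump_ge0.
have f1 l : f l <= 1 by exact: ebump_le1.
have mf (D : set R) : measurable_fun D f by exact: cc_smooth_measurable ccf.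
have mJ : measurable (`]0, 1[%classic : set (measurableTypeR R)) by exact:
    measurable_itv.
have muJ : (mu `]0%R, 1%R[ < +oo)%E by rewrite lebesgue_measure_itv/= lte_fin
    ltr01 -EFinB ltry.
have bnd1 (g : R -> R) : (forall l, `|g l| <= 1) ->
    measurable_fun (`]0, 1[%classic : set R) g ->
    mu.-integrable `]0, 1[ (EFin \o g).
  move=> g1 mg; apply: measurable_bounded_integrable => //.
  exists 1; split; first exact: num_real.
  by move=> y /ltW By x _ /=; apply: le_trans By; exact: g1.
have fi : mu.-integrable `]0, 1[ (EFin \o f).
  by apply: bnd1 => // l; rewrite ger0_norm.
pose Z := \int[mu]_(l in `]0, 1[) f l.
(* On this middle part, of length h, both factors l - l0 and l1 - l are at least h/2. It bounds the
   mass [Z] away from 0. *)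
pose K : set R := `[(eta + 3 / 2 * h), (eta + 5 / 2 * h)]%classic.
have mK : measurable (K : set (measurableTypeR R)) by exact: measurable_itv.
pose d := h / 2 * (h / 2); have d0 : 0 < d by rewrite mulr_gt0// divr_gt0.
have fd l : K l -> ebump d <= f l.
  rewrite /K /= in_itv/= => /andP[h1 h2]; apply: ebump_le => //.
  rewrite mul1r /d; apply: ler_pM; rewrite /l0 /l1; lra.
have iI : mu.-integrable `]0, 1[ (EFin \o (fun l => ebump d * \1_K l)).
  apply: bnd1.
    move=> l; rewrite ger0_norm ?mulr_ge0 ?ebump_ge0 ?indicE//.
    by rewrite -[leRHS]mulr1 ler_pM ?ebump_ge0 ?ebump_le1// lern1 leq_b1.
  by apply: measurable_funM => //; apply: measurable_indic.
have Z0 : 0 < Z.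
  apply: (@lt_le_trans _ _ (\int[mu]_(l in `]0, 1[) (ebump d * \1_K l)));
      last first.
    apply: le_Rintegral => // l _; rewrite indicE;
        case: (boolP (l \in K)) => [/set_mem/fd|_].
      by rewrite mulr1.
    by rewrite mulr0.
  rewrite RintegralZl//; last first.
    apply: bnd1; last exact: measurable_indic.
    by move=> l; rewrite indicE ger0_norm// lern1 leq_b1.
  rewrite mulr_gt0 ?ebump_gt0// /Rintegral integral_indic//.
  have -> : K `&` `]0, 1[ = K.
    apply/setIidPl => x; rewrite /K /= !in_itv/= => /andP[h1 h2].
    by apply/andP; split; lra.
  rewrite [X in fine X]lebesgue_measure_itv/= lte_fin.
  have -> : eta + 3 / 2 * h < eta + 5 / 2 * h by lra.
  by rewrite -EFinB /=; lra.
exists (fun l => Z^-1 * f l), l0, l1, Z^-1; split.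
- split=> //.
  + exact: measurable_funM.
  + by move=> l; rewrite ger0_norm ?mulr_ge0 ?invr_ge0 ?(ltW Z0)// ler_piMr
      ?invr_ge0 ?(ltW Z0).
  + move=> l; rewrite in_itv/= negb_and -!ltNge => hl.
    rewrite [f l]ebump_eq0 ?mulr0// mul1r.
    by case/orP: hl => hl; nra.
- have [sf [K' [cK KO K0]]] := ccf; split.
    by apply: smooth_onM; [exact: openT|apply: smooth_on_cst;
        exact: openT|exact: sf].
  by exists K'; split=> // x Kx; rewrite K0// mulr0.
- by move=> l; rewrite mulr_ge0// invr_ge0 ltW.
- by rewrite RintegralZl// -/Z mulVf// gt_eqF.
- by rewrite /l0 ltrDl.
Qed.

End averaging_kernel.

(** * Sobolev spaces on an interval *)

Section sobolev_on_interval.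
Context {R : realType}.
Local Notation mu := (@lebesgue_measure R).
Variables (a b : R).
Hypothesis ab : a < b.
Implicit Types (u v w f phi : R -> R) (p q : R).
Local Notation O := (`]a, b[%classic : set R).

Let mO : measurable (O : set (measurableTypeR R)).
Proof. exact: measurable_itv. Qed.

Let oO : open O. Proof. exact: itv_open. Qed.

Let muO : (mu O < +oo)%E.
Proof. by rewrite lebesgue_measure_itv/= lte_fin ab -EFinB ltry. Qed.

Lemma Lp_norm_powR p u : 0 < p -> (Lp_norm O p u `^ p = Lp_pow a b p u)%E.
Proof.
move=> p0; rewrite /Lp_norm powR_Lnorm; last by rewrite gt_eqF.
rewrite /Lp_pow [RHS]integral_mkcond.
apply: eq_integral => x _; rewrite /= !patchE; case: ifPn => //= _.
by rewrite normr0 powR0// gt_eqF.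
Qed.

Lemma LpP p u : 0 < p -> Lp O p u <-> measurable_fun O u /\ (Lp_pow a b p u <
    +oo)%E.
Proof.
move=> p0; rewrite -Lp_norm_powR//; split.
  rewrite /Lp /= inE => /andP[]; rewrite !inE /= => mu_ fin; split.
    exact: (measurable_restrictT _ mO).2.
  exact: poweR_lty.
move=> [mu_ fin]; rewrite /Lp /= inE; apply/andP; split; rewrite !inE /=.
  exact: (measurable_restrictT _ mO).1.
by apply: lty_poweRy fin; rewrite gt_eqF.
Qed.

Lemma Lp_pow1_integrable u : measurable_fun O u ->
  (Lp_pow a b 1 u < +oo)%E <-> mu.-integrable O (EFin \o u).
Proof.
move=> mu_; have E : Lp_pow a b 1 u = (\int[mu]_(x in O) `|(EFin \o u) x|)%E.
  by apply: eq_integral => x _; rewrite powRr1.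
split=> [fin|/integrableP[_]]; last by rewrite E.
by apply/integrableP; split; [exact/measurable_EFinP|rewrite -E].
Qed.

(** On an interval of finite length it suffices that |u| <= 1 + |u|^p. *)
Lemma Lp_integrable p u : 1 <= p -> Lp O p u -> mu.-integrable O (EFin \o u).
Proof.
move=> p1; have p0 : 0 < p by exact: lt_le_trans p1.
move=> /(LpP u p0)[mu_ fin].
have i1 : mu.-integrable O (EFin \o cst (1 : R)).
  apply: measurable_bounded_integrable => //.
  exists 1; split; first exact: num_real.
  by move=> y /ltW By x _ /=; rewrite normr1.
have := integrableD mO i1 (Lp_pow_integrable mu_ fin).
apply: le_integrable => //; first exact/measurable_EFinP.
move=> x _; rewrite -EFinD lee_fin /= [leRHS]ger0_norm ?addr_ge0 ?powR_ge0//.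
have [h|h] := leP `|u x| 1; first by rewrite (le_trans h)// lerDl powR_ge0.
apply: (le_trans (le1r_powR (ltW h) p1)); by rewrite lerDr.
Qed.

Lemma integrable_Lp1 u : mu.-integrable O (EFin \o u) -> Lp O 1 u.
Proof.
move=> iu; have mu_ : measurable_fun O u by case/integrableP : iu =>
    /measurable_EFinP.
by apply/LpP => //; split=> //; apply/Lp_pow1_integrable.
Qed.

(** The integration-by-parts identity common to both weak derivatives, with T = [derive1n k] or T an
    opposite-sided [RL_deriv]. *)
Definition weak_pairing (T : (R -> R) -> R -> R) (sg : R) u v :=
  forall f, cc_smooth O f ->
    \int[mu]_(x in O) (v x * f x) = sg * \int[mu]_(x in O) (u x * T f x).

Lemma cc_smooth_restrict f : cc_smooth O f -> f \_ O = f.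
Proof.
move=> [_ [K [_ KO K0]]]; apply/funext => x; rewrite patchE; case: ifPn =>
    // xO.
by rewrite K0// => /KO xO'; move: xO; rewrite mem_set.
Qed.

Lemma restrict_pairing v phi : \int[mu]_(x in O) (v x * phi x) =
  \int[mu]_(x in O) (v x * (phi \_ O) x).
Proof. by apply: eq_Rintegral => x xO; rewrite patchE xO. Qed.

Lemma weak_derivP k u v : is_weak_deriv O k u v <->
  [/\ locally_integrable O u, locally_integrable O v &
      weak_pairing (derive1n k) ((-1) ^+ k) u v].
Proof.
split=> -[lu lv H]; split=> //.
  by move=> f ccf; apply: H; exact: cc_smooth_test.
move=> phi tphi; rewrite restrict_pairing H; last exact: test_cc_smooth.
congr (_ * _); apply: eq_Rintegral => x /set_mem xO; congr (_ * _).
by apply: (@derive1n_eq _ O) => // y yO; rewrite patchE mem_set.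
Qed.

Lemma weak_frac_derivP s alpha u v : is_weak_frac_deriv s O alpha u v <->
  [/\ Lp O 1 u, locally_integrable O v &
      weak_pairing (RL_deriv (opposite s) alpha) ((-1) ^+ Num.truncn alpha) u
          v].
Proof.
split=> -[lu lv H]; split=> //.
  by move=> f ccf; rewrite H ?cc_smooth_restrict//; exact: cc_smooth_test.
by move=> phi tphi; rewrite restrict_pairing H//; exact: test_cc_smooth.
Qed.

Lemma weak_pairing_unique T sg u v w : locally_integrable O v ->
    locally_integrable O w ->
  weak_pairing T sg u v -> weak_pairing T sg u w ->
  {ae mu, forall x, O x -> v x = w x}.
Proof.
move=> lv lw Hv Hw.
have : {ae mu, forall x, O x -> (v \- w) x = 0}.
  apply: weak_zero; first exact: locally_integrableB.
  move=> f ccf; have iv := cc_smooth_integrable ccf lv.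
  have iw := cc_smooth_integrable ccf lw.
  transitivity (\int[mu]_(x in O) (v x * f x) - \int[mu]_(x in O) (w x * f x)).
    rewrite -(RintegralB mO iv iw); apply: eq_Rintegral => x _; exact: mulrBl.
  by rewrite Hv// Hw// subrr.
apply: filterS; first exact: (ae_filter_ringOfSetsType mu).
by move=> x H /H /eqP; rewrite subr_eq0 => /eqP.
Qed.

Lemma ae_eq_Lp_pow p v w : measurable_fun O v -> measurable_fun O w ->
  {ae mu, forall x, O x -> v x = w x} -> Lp_pow a b p v = Lp_pow a b p w.
Proof.
move=> mv mw H; apply: ae_eq_integral => //.
- exact: measurable_powR_norm.
- exact: measurable_powR_norm.
- move: H; apply: filterS; first exact: (ae_filter_ringOfSetsType mu).
  by move=> x H xO; rewrite H.
Qed.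

Lemma weak_pairingB T sg gam c u1 u2 v1 v2 : dilation_covariant a b c gam T ->
  mu.-integrable O (EFin \o u1) -> mu.-integrable O (EFin \o u2) ->
  mu.-integrable O (EFin \o v1) -> mu.-integrable O (EFin \o v2) ->
  weak_pairing T sg u1 v1 -> weak_pairing T sg u2 v2 ->
  weak_pairing T sg (u1 \- u2) (v1 \- v2).
Proof.
move=> covT iu1 iu2 iv1 iv2 H1 H2 f ccf.
have [M fM] := cc_smooth_bounded ccf; have [mT [N TN] _ _] := covT _ ccf.
have mf : measurable_fun O f by exact: cc_smooth_measurable ccf.
have jv1 := integrableM_bounded mO iv1 mf (fun x _ => fM x).
have jv2 := integrableM_bounded mO iv2 mf (fun x _ => fM x).
have ju1 := integrableM_bounded mO iu1 mT TN.
have ju2 := integrableM_bounded mO iu2 mT TN.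
transitivity (\int[mu]_(x in O) (v1 x * f x) - \int[mu]_(x in O) (v2 x * f x)).
  rewrite -(RintegralB mO jv1 jv2); apply: eq_Rintegral => x _; exact: mulrBl.
rewrite H1// H2// -mulrBr; congr (_ * _).
rewrite -(RintegralB mO ju1 ju2); apply: eq_Rintegral => x _; exact/esym/mulrBl.
Qed.

Lemma integrable_locally_integrable u : mu.-integrable O (EFin \o u) ->
    locally_integrable O u.
Proof. exact: open_integrable_locally. Qed.

(** The representative selected by [xget] is unknown, but by uniqueness it differs from v only on a
    null set. This gives access to the terms of the norm. *)
Lemma Lp_pow_weak_deriv p k u v : locally_integrable O u ->
    locally_integrable O v ->
  weak_pairing (derive1n k) ((-1) ^+ k) u v ->
  Lp_pow a b p (weak_deriv O k u) = Lp_pow a b p v.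
Proof.
move=> lu lv H; have h : is_weak_deriv O k u v by apply/weak_derivP.
have [_ lw Hw] := (weak_derivP _ _ _).1 (@xgetPex _ (fun=> 0) [set v |
    is_weak_deriv O k u v] (ex_intro _ v h)).
apply: ae_eq_Lp_pow; [by case: lw|by case: lv|].
exact: weak_pairing_unique lw lv Hw H.
Qed.

Lemma Lp_pow_weak_frac_deriv p s alpha u v : Lp O 1 u ->
    locally_integrable O v ->
  weak_pairing (RL_deriv (opposite s) alpha) ((-1) ^+ Num.truncn alpha) u v ->
  Lp_pow a b p (weak_frac_deriv s O alpha u) = Lp_pow a b p v.
Proof.
move=> lu lv H; have h : is_weak_frac_deriv s O alpha u v by
    apply/weak_frac_derivP.
have [_ lw Hw] := (weak_frac_derivP _ _ _ _).1
  (@xgetPex _ (fun=> 0) [set v | is_weak_frac_deriv s O alpha u v] (ex_intro _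
      v h)).
apply: ae_eq_Lp_pow; [by case: lw|by case: lv|].
exact: weak_pairing_unique lw lv Hw H.
Qed.

Lemma frac_sobolev_norm_powR s alpha p u : 0 < p ->
  frac_sobolev_norm s O alpha p u =
  ((Lp_pow a b p u + \sum_(1 <= k < (Num.truncn alpha).+1) Lp_pow a b p
      (weak_deriv O k u) +
   Lp_pow a b p (weak_frac_deriv s O alpha u)) `^ p^-1)%E.
Proof.
move=> p0; rewrite /frac_sobolev_norm /sobolev_norm; congr (_ `^ _)%E.
congr (_ + _)%E; last exact: Lp_norm_powR.
rewrite -poweRrM mulVf ?gt_eqF// poweRe1.
  rewrite Lp_norm_powR//; congr (_ + _)%E; apply: eq_bigr => k _;
      exact: Lp_norm_powR.
by rewrite adde_ge0 ?poweR_ge0//; apply: sume_ge0 => k _; exact: poweR_ge0.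
Qed.

End sobolev_on_interval.

(** * Simultaneous approximation and density *)

Section density.
Context {R : realType}.
Local Notation mu := (@lebesgue_measure R).
Variables (a b c p : R).
Hypotheses (ab : a < b) (hc : c = a \/ c = b) (p1 : 1 <= p).
Implicit Types (u v w k : R -> R).
Local Notation O := (`]a, b[%classic : set R).

Let p0 : 0 < p. Proof. exact: lt_le_trans p1. Qed.

Lemma Lp_pow_dil_approx_finite (W : nat -> R -> R) (G : nat ->
    R) (N : nat) (e : R) :
  (forall j, (j < N)%N -> [/\ 0 <= G j,
      measurable_fun O (W j) & (Lp_pow a b p (W j) < +oo)%E]) ->
  0 < e -> exists eta : R, [/\ 0 < eta, eta < 1 &
    forall j, (j < N)%N -> forall l, eta < l -> l < 1 ->
      (Lp_pow a b p (fun x => W j x - l `^ G j * W j (dil c l x))%R <= e%:E)%E].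
Proof.
move=> + e0; elim: N => [_|N IH H].
  by exists (1 / 2); split => //; lra.
have [|eta [eta0 eta1 heta]] := IH; first by move=> j jN; apply: H; exact: ltnW.
have [G0 mW fW] := H N (ltnSn N).
have [eta' [eta0' eta1' heta']] := Lp_pow_dil_approx ab p1 hc G0 mW fW e0.
exists (Num.max eta eta'); split.
- by rewrite lt_max eta0.
- by rewrite gt_max eta1.
move=> j; rewrite ltnS leq_eqVlt => /predU1P[-> l|jN l]; rewrite gt_max =>
    /andP[l1 l2] l3.
  exact: heta'.
exact: heta.
Qed.

Lemma avg_Lp w (V : R -> R) (e : R) : Lp O p w -> measurable_fun O V ->
  (Lp_pow a b p (fun x => w x - V x)%R <= e%:E)%E -> Lp O p V.
Proof.
move=> /(LpP a b w p0)[mw fw] mV h; apply/(LpP a b V p0); split;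
    first exact: mV.
have m1 : measurable_fun O (fun x => -1 * (w x - V x)).
  by apply: measurable_funM => //; exact: measurable_funB.
have m2 : measurable_fun O (fun x => w x - V x) by exact: measurable_funB.
have -> : V = (fun x => w x + -1 * (w x - V x)) by apply/funext => x; ring.
apply: (le_lt_trans (Lp_powD p1 mw m1)).
have h2 : (Lp_pow a b p (fun x => -1 * (w x - V x))%R < +oo)%E.
  apply: le_lt_trans (ltry e); apply: le_trans h;
      apply: (le_Lp_pow p1 m1 m2) => x _.
  by rewrite normrM normrN1 mul1r.
apply: lte_mul_pinfty; [by rewrite lee_fin powR_ge0|by []|exact:
    (lte_add_pinfty fw h2)].
Qed.

End density.

Section main.
Context {R : realType}.
Local Notation mu := (@lebesgue_measure R).

Lemma frac_sobolev_smooth_approx (a b alpha p e : R) (s : side) (u : R -> R) :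
  a < b -> 0 < alpha -> 1 <= p -> frac_sobolev s `]a, b[ alpha p u -> 0 < e ->
  exists g, [/\ smooth_on `]a, b[ g, frac_sobolev s `]a, b[ alpha p g &
    (frac_sobolev_norm s `]a, b[ alpha p (u \- g)%R < e%:E)%E].
Proof.
move=> ab alpha0 p1 [[Lpu Hk] [v0 Hv0 Lpv0]] e0.
have p0 : 0 < p by exact: lt_le_trans p1.
pose c := side_center a b s.
have hc : c = a \/ c = b by rewrite /c; case: (s); [left|right].
have acb : a <= c <= b by case: hc => ->; rewrite lexx ltW.
pose m := Num.truncn alpha.
(* Choice gathers the separately existing weak derivatives into one sequence. Orders outside the
   range receive a dummy value. *)
have [D HD] : exists D : nat -> R -> R, forall k, (0 < k <= m)%N ->
    is_weak_deriv `]a, b[ k u (D k) /\ Lp `]a, b[ p (D k).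
  have h k : exists v, (0 < k <= m)%N ->
      is_weak_deriv `]a, b[ k u v /\ Lp `]a, b[ p v.
    have [km|_] := boolP (0 < k <= m)%N; last by exists u.
    by have [v Hv Lv] := Hk _ km; exists v.
  by have [D HD] := choice h; exists D.
(* The finitely many functions to be averaged, each with its dilation weight. *)
pose W j := match j with 0%N => v0 | 1%N => u | k.+1 => D k end.
pose G j : R := match j with 0%N => alpha | 1%N => 0 | k.+1 => k%:R end.
have LW j : (j < m.+2)%N -> Lp `]a, b[ p (W j).
  case: j => [//|[//|j]] /= jm; apply: (HD j.+1 _).2.
  by rewrite /= -ltnS.
have G0 j : 0 <= G j by case: j => [|[|j]] //=; exact: ltW.
have iW j : (j < m.+2)%N -> mu.-integrable `]a, b[ (EFin \o W j).
  by move=> jm; exact: (Lp_integrable ab p1 (LW _ jm)).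
(* The p-th power of the norm has m + 2 terms: u, its m integer derivatives and the fractional one.
   Each is at most d, so the sum is strictly below e^p. *)
pose d := e `^ p / m.+3%:R.
have d0 : 0 < d by rewrite divr_gt0// powR_gt0.
have [eta [eta0 eta1 heta]] : exists eta : R, [/\ 0 < eta, eta < 1 &
    forall j, (j < m.+2)%N -> forall l, eta < l -> l < 1 ->
      (Lp_pow a b p (fun x => W j x - l `^ G j * W j (dil c l x))%R <= d%:E)%E].
  apply: Lp_pow_dil_approx_finite => // j jm.
  by have [] := (LpP a b _ p0).1 (LW _ jm).
have [k [l0 [l1 [B [hk cck k0 k1 etal0]]]]] := exists_averaging_kernel eta0
    eta1.
have l11 : l1 < 1 by case: hk.
pose V j := avg c (fun l => k l * l `^ G j) (W j).
have mV j : (j < m.+2)%N -> measurable_fun `]a, b[ (V j).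
  by move=> jm; exact: (avg_measurable ab hc (dil_kernel_powR (G0 j) hk) (iW _
      jm)).
have NpV j : (j < m.+2)%N -> (Lp_pow a b p (fun x =>
    W j x - V j x)%R <= d%:E)%E.
  move=> jm; apply: (Lp_pow_avg_le ab hc p1 (ltW d0) (G0 j) hk k0 k1 (iW _ jm)).
  move=> l; rewrite in_itv/= => /andP[h1 h2]; apply: heta => //.
    exact: lt_le_trans h1.
  exact: le_lt_trans l11.
have LV j : (j < m.+2)%N -> Lp `]a, b[ p (V j).
  by move=> jm; exact: (avg_Lp p1 (LW _ jm) (mV _ jm) (NpV _ jm)).
have iV j : (j < m.+2)%N -> mu.-integrable `]a, b[ (EFin \o V j).
  by move=> jm; exact: (Lp_integrable ab p1 (LV _ jm)).
(* The weight of u is l^0 = 1, so its average has the smooth kernel k itself, as [smooth_avg]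
   demands. *)
have V1 : V 1%N = avg c k u.
  rewrite /V /=; congr (avg c _ u); apply/funext => l; by rewrite powRr0 mulr1.
(* Index 0 being taken by the fractional derivative, the derivative of order j sits at index j +
   1. *)
have covT j : (0 < j)%N -> dilation_covariant a b c (G j.+1) (derive1n j).
  by case: j => // j _; exact: derive1n_covariant.
have Wweak j : (0 < j <= m)%N -> weak_pairing a b (derive1n j) ((-1) ^+ j) u (W
    j.+1).
  by move=> /[dup] jm /HD[/weak_derivP[_ _ +] _]; case: j jm.
have Wfrac : weak_pairing a b (RL_deriv (opposite s) alpha) ((-1) ^+ m) u v0.
  by have [_ _] := (weak_frac_derivP _ _ _ _ _ _).1 Hv0.
have m1 : (1 < m.+2)%N by [].
have Vweak j : (0 < j <= m)%N -> weak_pairing a b (derive1n j) ((-1) ^+ j) (V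
    1%N) (V j.+1).
  move=> jm; rewrite V1; have /andP[j0 jm'] := jm.
  exact: (avg_weak ab hc (G0 j.+1) (covT _ j0) hk (iW _ m1) (iW j.+1 jm')
      (Wweak _ jm)).
have Vfrac : weak_pairing a b (RL_deriv (opposite s) alpha) ((-1) ^+ m) (V 1%N)
    (V 0%N).
  rewrite V1.
  exact: (avg_weak ab hc (G0 0%N) (RL_covariant s ab alpha0) hk (iW _ m1) (iW
      0%N isT) Wfrac).
exists (V 1%N); split.
- by rewrite V1; exact: (smooth_avg ab hc cck (iW _ m1)).
- split; last first.
    exists (V 0%N); last exact: LV.
    apply/weak_frac_derivP; split;
        [|exact/integrable_locally_integrable/iV|exact: Vfrac].
    by apply: integrable_Lp1; exact: iV.
  split; first exact: LV.
  move=> j jm; exists (V j.+1); last by apply: LV; case/andP: jm.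
  apply/weak_derivP; split; [exact/integrable_locally_integrable/iV| |exact:
      Vweak].
  by apply/integrable_locally_integrable/iV; case/andP: jm.
have iuV : mu.-integrable `]a, b[ (EFin \o (u \- V 1%N)).
  have mO : measurable (`]a, b[%classic : set (measurableTypeR R)) by exact:
      measurable_itv.
  have := integrableB mO (iW _ m1) (iV _ m1).
  exact: eq_integrable.
have liWV j : (j < m.+2)%N -> locally_integrable `]a, b[ (W j \- V j).
  by move=> jm; apply: locally_integrableB;
      apply: integrable_locally_integrable; [exact: iW|exact: iV].
rewrite frac_sobolev_norm_powR//.
(* By linearity W - V is the weak derivative of the error, so the selected representative can be
   replaced by it. The integer orders are treated likewise below. *)
rewrite (Lp_pow_weak_frac_deriv p (integrable_Lp1 iuV) (liWV 0%N isT));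
    last first.
  exact: (weak_pairingB (RL_covariant s ab alpha0) (iW _ m1) (iV _ m1) (iW 0%N
      isT) (iV 0%N isT) Wfrac Vfrac).
apply: (@le_lt_trans _ _ ((d *+ m.+2)%:E `^ p^-1)%E).
  apply: gt0_ler_poweR.
  - by rewrite invr_ge0 ltW.
  - rewrite in_itv/= leey andbT; apply: adde_ge0; last exact: Lp_pow_ge0.
    apply: adde_ge0; first exact: Lp_pow_ge0.
    by apply: sume_ge0 => j _; exact: Lp_pow_ge0.
  - by rewrite in_itv/= leey andbT lee_fin mulrn_wge0 ?ltW.
  have -> : (d *+ m.+2)%:E = (d%:E + \sum_(1 <= j < m.+1) d%:E + d%:E)%E.
    rewrite sumEFin -!EFinD; congr EFin.
    by rewrite big_const_nat subSS subn0 iter_addr_0 mulrS addrC;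
        congr (_ + _); rewrite -mulrS.
  apply: leeD; last exact: NpV.
  apply: leeD; first exact: (NpV 1%N).
  rewrite big_nat_cond [leRHS]big_nat_cond; apply: lee_sum => j /andP[+ _].
  rewrite ltnS => jm; have /andP[j0 jm'] := jm.
  rewrite (@Lp_pow_weak_deriv _ a b p j (u \- V 1%N) (W j.+1 \- V j.+1)).
  - exact: NpV.
  - exact: integrable_locally_integrable.
  - exact: liWV.
  - exact: (weak_pairingB (covT _ j0) (iW _ m1) (iV _ m1) (iW j.+1 jm') (iV
      j.+1 jm') (Wweak _ jm) (Vweak _ jm)).
rewrite poweR_EFin lte_fin.
have -> : e = (e `^ p) `^ p^-1 by rewrite -powRrM mulfV ?gt_eqF// powRr1// ltW.
apply: gt0_ltr_powR.
- by rewrite invr_gt0.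
- by rewrite nnegrE mulrn_wge0// ltW.
- by rewrite nnegrE powR_ge0.
by rewrite /d -mulr_natr -mulrA gtr_pMr ?powR_gt0// mulrC ltr_pdivrMr// mul1r
    ltr_nat.
Qed.

End main.

Theorem theorem4p3 (R : realType) (a b alpha p : R) (s : side)
    (hab : a < b) (halpha : 0 < alpha) (hp : 1 <= p) :
  frac_sobolev_bar s `]a, b[ alpha p = frac_sobolev s `]a, b[ alpha p.
Proof.
apply/seteqP; split=> [u []//|u Hu]; split=> // e e0.
exact: frac_sobolev_smooth_approx.
Qed.
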